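(* Let $M$ be the rank-$3$ matroid on the point set $[d]$ of one of the following finite planes, whose dependent hyperplanes (lines) are the lines of the plane (so a $3$-subset is dependent iff it lies on a line, and every $4$-subset is dependent): the projective planes $\mathrm{PG}(2,2)$ ($d=7$) or $\mathrm{PG}(2,3)$ ($d=13$), or the affine planes $\mathrm{AG}(2,3)$ ($d=9$) or $\mathrm{AG}(2,4)$ ($d=16$). Let $B$ be its set of lines. Then the set of maximal elements, in the weak order, of $\{N : N<M\}$ (matroids on $[d]$) consists exactly of: - for each $b\in B$, the rank-$3$ matroid $M_b$ on $[d]$ whose circuits of size at most $3$ are exactly the $3$-subsets of $b$ and the $2$-subsets of $[d]\setminus b$; - for each $i\in[d]$, the matroid $M_i$ on $[d]$ which is the direct sum of the rank-one matroid on $\{i\}$ (so $i$ is a coloop) and the rank-$2$ loopless matroid on $[d]\setminus\{i\}$ whose parallel classes are the sets $b\setminus\{i\}$ for $b\in B$ with $i\in b$; - for each $i\in[d]$, the matroid $M(i)$ whose circuits are the circuits of the deletion $M\setminus i$ together with $\{i\}$; - the uniform matroid $U_{2,d}$ of rank $2$ on $[d]$.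
   Context: The weak order on matroids on a common ground set: $N\le M$ iff every dependent set of $M$ is dependent in $N$; $N<M$ means $N\le M$ and $N\ne M$. *)

(* Defs.v *)
From HB Require Import structures.
From mathcomp Require Import all_boot all_algebra.

Set Implicit Arguments.
Unset Strict Implicit.
Unset Printing Implicit Defensive.

Import GRing.Theory.

Section Matroids.
Variable T : finType.
Implicit Types (A C E H : {set T}) (e x y : T).

Definition matroid_axioms E (I : {set {set T}}) : bool :=
  [&& [forall A in I, A \subset E],
      set0 \in I,
      [forall A in I, forall C : {set T}, (C \subset A) ==> (C \in I)]
    & [forall A in I, forall C in I,
         (#|A| < #|C|) ==> [exists x in C :\: A, x |: A \in I]]].

(* The ground set is a field, so that deletions and the summands of a direct
   sum live over the same carrier type; "a matroid on [d]" is a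
   [matroid 'I_d] whose ground set is [setT].  As [matroid_axioms] is boolean,
   two matroids are equal as soon as their ground sets and independent sets
   are. *)
Record matroid := Matroid {
  ground : {set T};
  indep : {set {set T}};
  _ : matroid_axioms ground indep }.

Implicit Types M N : matroid.

Definition dependent M A : bool := (A \subset ground M) && (A \notin indep M).

Definition circuit M C : bool :=
  dependent M C && [forall A : {set T}, (A \proper C) ==> (A \in indep M)].

Definition rk M A : nat := \max_(C in indep M | C \subset A) #|C|.

Definition rank M : nat := rk M (ground M).

Definition flat M A : bool :=
  (A \subset ground M) && [forall e in ground M :\: A, rk M A < rk M (e |: A)].

Definition hyperplane M H : bool := flat M H && ((rk M H).+1 == rank M).

Definition dependent_hyperplanes M : {set {set T}} :=
  [set H | hyperplane M H && dependent M H].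

Definition loop M e : bool := dependent M [set e].

Definition loopless M : bool := [forall e, ~~ loop M e].

Definition parallel_class M x : {set T} :=
  [set y in ground M | ~~ loop M y && ((y == x) || dependent M [set x; y])].

Definition parallel_classes M : {set {set T}} :=
  [set parallel_class M x | x in [set x in ground M | ~~ loop M x]].

Definition weak_le N M : Prop :=
  ground N = ground M /\ (forall A, dependent M A -> dependent N A).

Definition weak_lt N M : Prop := weak_le N M /\ N <> M.

Definition maximal_below M N : Prop :=
  weak_lt N M /\ (forall N', weak_lt N' M -> weak_le N N' -> N' = N).

Fact deletion_subproof M e :
  matroid_axioms (ground M :\ e) [set A in indep M | e \notin A].
Proof.
case: M => E I /= /and4P[/forall_inP sIE I0 /forall_inP hI /forall_inP aI].
apply/and4P; split.
- by apply/forall_inP=> A; rewrite inE subsetD1 => /andP[/sIE-> ->].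
- by rewrite !inE I0.
- apply/forall_inP=> A; rewrite inE => /andP[IA eA].
  apply/forallP=> C; apply/implyP=> sCA; rewrite inE.
  have /forallP/(_ C)/implyP-> //= := hI A IA.
  by apply: contra eA; apply: (subsetP sCA).
- apply/forall_inP=> A; rewrite inE => /andP[IA eA].
  apply/forall_inP=> C; rewrite inE => /andP[IC eC]; apply/implyP=> ltAC.
  have /forall_inP/(_ C IC)/implyP/(_ ltAC)/exists_inP[x xCA IxA] := aI A IA.
  apply/exists_inP; exists x => //; rewrite inE IxA !inE negb_or eA andbT.
  by apply: contraNneq eC => ->; move: xCA; rewrite inE => /andP[].
Qed.

Definition deletion M e : matroid := Matroid (deletion_subproof M e).

Fact uniform_subproof k : matroid_axioms setT [set A : {set T} | #|A| <= k].
Proof.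
apply/and4P; split.
- by apply/forall_inP=> A _; apply: subsetT.
- by rewrite inE cards0.
- apply/forall_inP=> A; rewrite inE => leAk; apply/forallP=> C.
  by apply/implyP=> /subset_leq_card leCA; rewrite inE (leq_trans leCA).
- apply/forall_inP=> A _; apply/forall_inP=> C; rewrite inE => leCk.
  apply/implyP=> ltAC; apply/exists_inP.
  have /subsetPn[x Cx nAx] : ~~ (C \subset A).
    by apply: contraL ltAC => /subset_leq_card; rewrite -leqNgt.
  by exists x; rewrite !inE ?Cx ?nAx // cardsU1 nAx (leq_trans _ leCk).
Qed.

Definition uniform k : matroid := Matroid (uniform_subproof k).

Definition is_direct_sum N N1 N2 : Prop :=
  [/\ [disjoint ground N1 & ground N2],
      ground N = ground N1 :|: ground N2
    & indep N = [set A1 :|: A2 | A1 in indep N1, A2 in indep N2]].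

Definition is_plane_matroid (B : {set {set T}}) M : Prop :=
  [/\ ground M = setT, rank M = 3 & dependent_hyperplanes M = B].

(* [N] is M_b. *)
Definition is_line_degeneration (b : {set T}) N : Prop :=
  [/\ ground N = setT, rank N = 3 &
      forall C, #|C| <= 3 ->
        circuit N C = ((#|C| == 3) && (C \subset b))
                      || ((#|C| == 2) && (C \subset ~: b))].

(* [N] is M_i. *)
Definition is_coloop_degeneration (B : {set {set T}}) (i : T) N : Prop :=
  exists N1 N2 : matroid,
    [/\ ground N1 = [set i] /\ rank N1 = 1,
        ground N2 = ~: [set i] /\ rank N2 = 2,
        loopless N2,
        parallel_classes N2 = [set b :\ i | b in [set b in B | i \in b]]
      & is_direct_sum N N1 N2].

(* [N] is M(i). *)
Definition is_loop_degeneration M (i : T) N : Prop :=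
  ground N = setT /\
  (forall C, circuit N C <-> circuit (deletion M i) C \/ C = [set i]).

End Matroids.

Arguments uniform : clear implicits.

(* [B] is the set of lines of PG(2, q) (resp. AG(2, q)) after some labelling
   [phi] of the points of the plane by 'I_d. *)
Definition is_PG2 (q d : nat) (B : {set {set 'I_d}}) : Prop :=
  exists (F : finFieldType) (phi : 'I_d -> {vspace 'rV[F]_3}),
    [/\ #|F| = q,
        injective phi,
        forall U : {vspace 'rV[F]_3}, \dim U = 1 <-> exists i, phi i = U
      & forall b : {set 'I_d}, b \in B <->
          exists W : {vspace 'rV[F]_3},
            \dim W = 2 /\ b = [set i | (phi i <= W)%VS]].

Definition is_AG2 (q d : nat) (B : {set {set 'I_d}}) : Prop :=
  exists (F : finFieldType) (phi : 'I_d -> 'rV[F]_2),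
    [/\ #|F| = q,
        bijective phi
      & forall b : {set 'I_d}, b \in B <->
          exists (x : 'rV[F]_2) (U : {vspace 'rV[F]_2}),
            \dim U = 1 /\ b = [set i | (phi i - x)%R \in U]].

(* Main.v *)
(** A plane matroid M enters only through two properties of collinearity: the
    incidence axioms [plane], shared by the projective and the affine planes,
    and the rigidity [rainbow_rigid] of three-colourings without a rainbow line.

    Let N < M have rank 3 and no loop; otherwise N <= U_{2,d} or N <= M(i).  If
    N is simple, a line of N containing a triangle of M is closed under the
    lines of M, hence is everything.  So N has a parallel pair.  Let P be its
    parallel class and L a line of N through P.  The colouring with classes P,
    L \ P and the complement of L has no rainbow line, since a line of M that
    meets P and L \ P lies in L.  Rigidity, applied to all the lines of N
    through P, forces either the complement of some line b to be a parallel
    class (N <= M_b) or the complement of some point i to be a line of N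
    (N <= M_i).

    The incidence axioms hold for the lines <v> of a three-dimensional space
    that do not lie in a fixed subspace H, which is 0 in the projective and a
    hyperplane in the affine case.  Rigidity is an exhaustive search: the three
    colours occur on a triangle, which may be taken as the basis of homogeneous
    (projective case) or barycentric (affine case) coordinates. *)

Require Import Defs.
From mathcomp Require Import all_boot all_algebra all_field.

Set Implicit Arguments.
Unset Strict Implicit.
Unset Printing Implicit Defensive.

(** * Independent sets, rank and closure *)

Section IndependentSets.
Variable T : finType.
Implicit Types (M N : matroid T) (A C D : {set T}) (x : T).

Lemma matroid_eq M N : ground M = ground N -> indep M = indep N -> M = N.
Proof.
case: M N => E I axM [E' I' axN] /= eqE eqI; rewrite -{}eqE -{}eqI in axN *.
by rewrite (bool_irrelevance axM axN).
Qed.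

Lemma indep_ground M A : A \in indep M -> A \subset ground M.
Proof. by case: M => E I /= /and4P[/forall_inP sIE _ _ _]; apply: sIE. Qed.

Lemma indep0 M : set0 \in indep M.
Proof. by case: M => E I /= /and4P[]. Qed.

Lemma indepS M A C : C \subset A -> A \in indep M -> C \in indep M.
Proof.
case: M => E I /= /and4P[_ _ /forall_inP IS _] sCA.
by move=> /IS/forallP/(_ C)/implyP; apply.
Qed.

Lemma indep_augment M A C :
    A \in indep M -> C \in indep M -> #|A| < #|C| ->
  exists x, [/\ x \in C, x \notin A & x |: A \in indep M].
Proof.
case: M => E I /= /and4P[_ _ _ /forall_inP aug].
move=> /aug/forall_inP augA /augA/implyP augAC.
by move=> /augAC/exists_inP[x /setDP[Cx nAx] Ix]; exists x.
Qed.

Lemma weak_leE M N : ground M = setT -> ground N = setT ->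
  weak_le N M <-> indep N \subset indep M.
Proof.
move=> gM gN; split=> [[_ dep]|/subsetP sNM].
  apply/subsetP=> A; apply: contraLR => nIA.
  by have /andP[] : dependent N A by apply: dep; rewrite /dependent gM subsetT.
split; rewrite ?gM // => A; rewrite /dependent gM gN !subsetT /=.
by apply: contra; apply: sNM.
Qed.

End IndependentSets.

Section Rank.
Variables (T : finType) (M : matroid T).
Implicit Types (A C D : {set T}) (x y z : T).

Lemma leq_rk A C : C \in indep M -> C \subset A -> #|C| <= rk M A.
Proof.
move=> IC sCA.
by apply: (@leq_bigmax_cond _ _ (fun D : {set T} => #|D|)); rewrite IC.
Qed.

Lemma rk_leqP A k :
  reflect (forall C, C \in indep M -> C \subset A -> #|C| <= k) (rk M A <= k).
Proof.
apply: (iffP idP) => [le_k C IC sCA|le_k].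
  exact: leq_trans (leq_rk IC sCA) le_k.
by apply/bigmax_leqP=> C /andP[IC sCA]; apply: le_k.
Qed.

Lemma rk_card A : rk M A <= #|A|.
Proof. by apply/rk_leqP=> C _; apply: subset_leq_card. Qed.

Lemma rkS A C : A \subset C -> rk M A <= rk M C.
Proof.
by move=> sAC; apply/rk_leqP=> D ID sDA; apply: leq_rk (subset_trans sDA sAC).
Qed.

Lemma rk_set0 : rk M set0 = 0.
Proof. by apply/eqP; rewrite -leqn0 -(cards0 T) rk_card. Qed.

Lemma indep_extend A C : A \in indep M -> A \subset C ->
  exists D, [/\ D \in indep M, A \subset D, D \subset C & #|D| = rk M C].
Proof.
move=> IA sAC; pose P D := (D \in indep M) && (D \subset C).
have [|D /maxsetP[/andP[ID sDC] maxD] sAD] := @maxset_exists _ P A.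
  by rewrite /P IA.
exists D; split=> //; apply/eqP; rewrite eqn_leq leq_rk //=.
apply/rk_leqP=> E IE sEC; rewrite leqNgt; apply/negP=> ltDE.
have [x [Ex nDx IxD]] := indep_augment ID IE ltDE; case/negP: nDx.
rewrite -(maxD (x |: D)) ?setU11 ?subsetUr // /P IxD subUset sDC.
by rewrite sub1set (subsetP sEC).
Qed.

Definition basis A : {set T} :=
  [arg max_(C > set0 | (C \in indep M) && (C \subset A)) #|C|].

Lemma basisP A :
  [/\ basis A \in indep M, basis A \subset A & #|basis A| = rk M A].
Proof.
rewrite /basis; case: arg_maxnP => [|C /andP[IC sCA] maxC].
  by rewrite indep0 sub0set.
split=> //; apply/eqP; rewrite eqn_leq leq_rk //=.
by apply/rk_leqP=> D ID sDA; apply: maxC; rewrite ID.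
Qed.

Lemma rk_indep A : A \in indep M -> rk M A = #|A|.
Proof. by move=> IA; apply/eqP; rewrite eqn_leq rk_card leq_rk. Qed.

Lemma basis_id A : #|A| <= rk M A -> basis A = A.
Proof.
by have [_ sCA cC] := basisP A => leA; apply/eqP; rewrite eqEcard sCA cC.
Qed.

Lemma indep_rkE A : (A \in indep M) = (#|A| <= rk M A).
Proof.
apply/idP/idP=> [/rk_indep-> //|/basis_id eqA].
by have [IA _ _] := basisP A; rewrite -eqA.
Qed.

Lemma rk_submod A C : rk M (A :|: C) + rk M (A :&: C) <= rk M A + rk M C.
Proof.
have [ID0 sD0 <-] := basisP (A :&: C).
have sD0A : basis (A :&: C) \subset A := subset_trans sD0 (subsetIl _ _).
have [D1 [ID1 sD01 sD1A cD1]] := indep_extend ID0 sD0A.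
have [D [ID sD1 sD <-]] := indep_extend ID1 (subset_trans sD1A (subsetUl A C)).
have -> : D = (D :&: A) :|: (D :&: C) by rewrite -setIUr (setIidPl sD).
have sI A' : D :&: A' \in indep M by apply: indepS (subsetIl _ _) ID.
have leD0 : #|basis (A :&: C)| <= #|(D :&: A) :&: (D :&: C)|.
  apply: subset_leq_card; rewrite !subsetI sD0A (subset_trans sD01 sD1).
  by rewrite (subset_trans sD0 (subsetIr _ _)).
rewrite (leq_trans (leq_add (leqnn _) leD0)) // cardsUI.
by rewrite leq_add // leq_rk // subsetIr.
Qed.

Lemma rkU1_leq x A : rk M (x |: A) <= (rk M A).+1.
Proof.
apply: leq_trans (leq_addr (rk M ([set x] :&: A)) _) _.
apply: leq_trans (rk_submod _ _) _.
by rewrite -add1n leq_add2r -(cards1 x) rk_card.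
Qed.

Lemma rkU1_eqS x A C :
  A \subset C -> rk M (x |: A) = rk M A -> rk M (x |: C) = rk M C.
Proof.
move=> sAC eqA; apply/eqP; rewrite eqn_leq (rkS (subsetUr _ _)) andbT.
have sA : A \subset (x |: A) :&: C by rewrite subsetI subsetUr.
rewrite -(leq_add2l (rk M A)) -{2}eqA -{1}(setUidPr sAC) setUA addnC.
exact: leq_trans (leq_add (leqnn _) (rkS sA)) (rk_submod _ _).
Qed.

Lemma rkU_eq A C :
  (forall x, x \in C -> rk M (x |: A) = rk M A) -> rk M (A :|: C) = rk M A.
Proof.
move=> eqA; apply/eqP; rewrite eqn_leq (rkS (subsetUl _ _)) andbT.
have [ID sDA cD] := basisP A; have [IE sE <-] := basisP (A :|: C).
rewrite -cD leqNgt; apply/negP=> ltDE.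
have [x [Ex nDx IxD]] := indep_augment ID IE ltDE.
have : #|x |: basis A| <= rk M (x |: A) by rewrite leq_rk ?setUS.
rewrite cardsU1 nDx cD ltnNge => /negP[].
have /setUP[Ax|/eqA->//] := subsetP sE x Ex.
by rewrite (setUidPr _) // sub1set.
Qed.

Definition cl A := [set x in ground M | rk M (x |: A) == rk M A].

Lemma sub_cl A : A \subset ground M -> A \subset cl A.
Proof.
move=> sAE; apply/subsetP=> x Ax; rewrite inE (subsetP sAE) //=.
by rewrite (setUidPr _) // sub1set.
Qed.

Lemma rk_cl A : A \subset ground M -> rk M (cl A) = rk M A.
Proof.
move=> sAE; rewrite -{1}(setUidPr (sub_cl sAE)).
by apply: rkU_eq => x; rewrite inE => /andP[_ /eqP].
Qed.

Lemma cl_flat A : A \subset ground M -> flat M (cl A).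
Proof.
move=> sAE; apply/andP; split; first by apply/subsetP=> x /setIdP[].
apply/forall_inP=> x; rewrite inE [x \in cl A]inE negb_and => /andP[+ Ex].
rewrite Ex rk_cl //= => neqA.
apply: leq_trans (rkS (setUS [set x] (sub_cl sAE))).
by rewrite ltn_neqAle eq_sym neqA rkS ?subsetUr.
Qed.

End Rank.

Lemma rk_indepS (T : finType) (M N : matroid T) (A : {set T}) :
  indep N \subset indep M -> rk N A <= rk M A.
Proof.
by move=> /subsetP sNM; apply/rk_leqP=> C /sNM IC sCA; apply: leq_rk.
Qed.

Lemma coloop_indep (T : finType) (N : matroid T) (i : T) (A : {set T}) :
  rk N (~: [set i]) < rk N setT -> A \in indep N -> i |: A \in indep N.
Proof.
move=> lt_rk /indep_extend/(_ (subsetT A))[D [ID sAD _ cD]].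
apply: indepS (ID); rewrite subUset sAD sub1set andbT.
apply: contraLR lt_rk => nDi.
by rewrite -leqNgt -cD leq_rk // subsetC sub1set inE.
Qed.

Section Circuits.
Variable T : finType.
Implicit Types (M N : matroid T) (A C D : {set T}).

Lemma dependent_circuit M A :
  dependent M A -> exists2 C : {set T}, C \subset A & circuit M C.
Proof.
move=> /(minset_exists (P := dependent M))[C /minsetP[depC minC] sCA].
exists C => //; rewrite /circuit depC; apply/forallP=> D; apply/implyP=> prDC.
apply: contraTT (prDC) => nID; rewrite (minC D) ?properxx ?proper_sub //.
rewrite /dependent nID andbT (subset_trans (proper_sub prDC)) //.
by case/andP: depC.
Qed.

Lemma circuit_notin_indep M C : circuit M C -> C \notin indep M.
Proof. by case/andP=> /andP[]. Qed.

Lemma indep_circuitsP M A : A \subset ground M ->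
  reflect (forall C : {set T}, C \subset A -> ~~ circuit M C) (A \in indep M).
Proof.
move=> sAE; apply: (iffP idP) => [IA C sCA|noC].
  by apply: contraTN (indepS sCA IA) => /circuit_notin_indep.
apply: contraT => nIA; have /dependent_circuit[C sCA] : dependent M A.
  by rewrite /dependent sAE.
by rewrite (negbTE (noC C sCA)).
Qed.

Lemma circuit_min M C D :
  circuit M C -> D \subset C -> D \notin indep M -> D = C.
Proof.
case/andP=> _ /forallP/(_ D)/implyP minC sDC; apply: contraNeq => neqDC.
by apply: minC; rewrite properEneq neqDC.
Qed.

Lemma eq_circuit M N C :
    C \subset ground M -> C \subset ground N ->
    (forall D : {set T}, D \subset C -> (D \in indep M) = (D \in indep N)) ->
  circuit M C = circuit N C.
Proof.
move=> sCM sCN eqI; rewrite /circuit /dependent sCM sCN (eqI C) //.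
congr (_ && _); apply: eq_forallb => D; case: (boolP (D \proper C)) => //= prD.
by rewrite eqI ?proper_sub.
Qed.

Lemma matroid_eq_circuits_leq M N r :
    ground M = ground N -> rank M <= r -> rank N <= r ->
    (forall C : {set T}, #|C| <= r -> circuit M C = circuit N C) ->
  M = N.
Proof.
move=> eqE rM rN eqC; apply: matroid_eq => //.
have le_r M' C : rank M' <= r -> C \in indep M' -> #|C| <= r.
  by move=> rM' IC; apply: leq_trans (leq_rk IC (indep_ground IC)) rM'.
have sub M1 M2 : ground M1 = ground M2 -> rank M1 <= r ->
    (forall C : {set T}, #|C| <= r -> circuit M1 C = circuit M2 C) ->
    indep M1 \subset indep M2.
  move=> eqE' r1 eqC'; apply/subsetP=> A IA; have sAE := indep_ground IA.
  apply/indep_circuitsP; rewrite -?eqE' // => C sCA.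
  rewrite -eqC' ?(le_r M1) ?(indepS sCA) //.
  by apply/indep_circuitsP: C sCA.
by apply/eqP; rewrite eqEsubset !sub // => C /eqC.
Qed.

End Circuits.

(** * Uniform matroids, direct sums and contractions *)

Section Uniform.
Variables (T : finType) (E : {set T}) (k : nat).
Implicit Types A C : {set T}.

Fact uniform_on_subproof :
  matroid_axioms E [set A : {set T} | (A \subset E) && (#|A| <= k)].
Proof.
apply/and4P; split.
- by apply/forall_inP=> A; rewrite inE => /andP[].
- by rewrite inE sub0set cards0.
- apply/forall_inP=> A; rewrite inE => /andP[sAE leAk]; apply/forallP=> C.
  apply/implyP=> sCA; rewrite inE (subset_trans sCA sAE).
  exact: leq_trans (subset_leq_card sCA) leAk.
- apply/forall_inP=> A; rewrite inE => /andP[sAE _]; apply/forall_inP=> C.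
  rewrite inE => /andP[sCE leCk]; apply/implyP=> ltAC; apply/exists_inP.
  have /subsetPn[x Cx nAx] : ~~ (C \subset A).
    by apply: contraL ltAC => /subset_leq_card; rewrite -leqNgt.
  exists x; first by rewrite inE nAx.
  rewrite inE subUset sub1set (subsetP sCE) // sAE cardsU1 nAx.
  exact: leq_trans ltAC leCk.
Qed.

Definition uniform_on : matroid T := Matroid uniform_on_subproof.

Lemma circuit_uniform_on C :
  circuit uniform_on C = (C \subset E) && (#|C| == k.+1).
Proof.
rewrite /circuit /dependent inE /=; have [sCE|] //= := boolP (C \subset E).
rewrite -ltnNge; apply/andP/eqP=> [[gtk /forallP minC]|cC].
  have /card_gt0P[x Cx] : 0 < #|C| by apply: leq_trans gtk.
  apply/eqP; rewrite eqn_leq gtk (cardsD1 x) Cx add1n ltnS andbT.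
  have := minC (C :\ x); rewrite properD1 //= inE => /andP[_].
  exact.
split; first by rewrite cC.
apply/forallP=> D; apply/implyP=> prD; rewrite inE -ltnS -cC proper_card //.
by rewrite (subset_trans (proper_sub prD)).
Qed.

Lemma rank_uniform_on : k <= #|E| -> rank uniform_on = k.
Proof.
move=> leqkE; apply/eqP; rewrite eqn_leq; apply/andP; split.
  by apply/rk_leqP=> C; rewrite inE => /andP[].
have /card_geqP[s [uniq_s size_s sE]] := leqkE.
have <- : #|[set x in s]| = k by rewrite cardsE (card_uniqP uniq_s).
have sS : [set x in s] \subset E by apply/subsetP=> x; rewrite inE => /sE.
by apply: leq_rk; rewrite // inE sS cardsE (card_uniqP uniq_s) size_s leqnn.
Qed.

End Uniform.

Lemma full_rank_uniform (T : finType) (N : matroid T) :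
  rank N = #|ground N| -> N = uniform_on (ground N) #|ground N|.
Proof.
move=> full; apply: matroid_eq => //; apply/setP=> A; rewrite inE.
apply/idP/andP=> [IA|[sAE _]].
  by rewrite indep_ground // subset_leq_card // indep_ground.
by apply: indepS sAE _; rewrite indep_rkE -/(rank N) full.
Qed.

Section DirectSum.
Variables (T : finType) (N1 N2 : matroid T).
Implicit Types A C D : {set T}.

(* On overlapping ground sets the second summand is restricted to the
   complement of the first one, so that no disjointness is needed here. *)
Fact direct_sum_subproof :
  matroid_axioms (ground N1 :|: ground N2)
    [set A | (A :&: ground N1 \in indep N1) && (A :\: ground N1 \in indep N2)].
Proof.
set E := ground N1; apply/and4P; split.
- apply/forall_inP=> A; rewrite inE => /andP[/indep_ground s1 /indep_ground s2].
  by rewrite -(setID A E) setUSS.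
- by rewrite inE set0I set0D !indep0.
- apply/forall_inP=> A; rewrite inE => /andP[I1 I2]; apply/forallP=> C.
  by apply/implyP=> sCA;
    rewrite inE (indepS _ I1) ?setSI // (indepS _ I2) ?setSD.
- apply/forall_inP=> A; rewrite inE => /andP[IA1 IA2]; apply/forall_inP=> C.
  rewrite inE => /andP[IC1 IC2]; apply/implyP=> ltAC; apply/exists_inP.
  have [leAC|ltI] := leqP #|C :&: E| #|A :&: E|; last first.
    have [x [/setIP[Cx Ex] nAx IxA]] := indep_augment IA1 IC1 ltI.
    rewrite inE Ex andbT in nAx; exists x; first by rewrite inE nAx.
    rewrite inE setIUl setDUl (setIidPl _) ?sub1set // IxA.
    by have /eqP-> : [set x] :\: E == set0; rewrite ?set0U // setD_eq0 sub1set.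
  have ltD : #|A :\: E| < #|C :\: E|.
    rewrite -(ltn_add2l #|A :&: E|) cardsID (leq_trans ltAC) //.
    by rewrite -(cardsID E C) leq_add2r.
  have [x [/setDP[Cx nEx] nAx IxA]] := indep_augment IA2 IC2 ltD.
  rewrite inE nEx /= in nAx; exists x; first by rewrite inE nAx.
  rewrite inE setIUl setDUl [[set x] :\: E](setDidPl _) ?disjoints1 // IxA.
  have /eqP-> : [set x] :&: E == set0 by rewrite setI_eq0 disjoints1.
  by rewrite set0U IA1.
Qed.

Definition direct_sum : matroid T := Matroid direct_sum_subproof.

Hypothesis disj : [disjoint ground N1 & ground N2].

Lemma indep_direct_suml A :
  A \subset ground N1 -> (A \in indep direct_sum) = (A \in indep N1).
Proof.
move=> sA; rewrite inE (setIidPl sA).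
by have /eqP-> : A :\: ground N1 == set0; rewrite ?setD_eq0 // indep0 andbT.
Qed.

Lemma indep_direct_sumr A :
  A \subset ground N2 -> (A \in indep direct_sum) = (A \in indep N2).
Proof.
move=> sA; have disjA : [disjoint A & ground N1].
  by rewrite disjoint_sym (disjointWr sA).
rewrite inE (setDidPl disjA); move: disjA; rewrite -setI_eq0 => /eqP->.
by rewrite indep0.
Qed.

Lemma circuit_direct_sum C :
  circuit direct_sum C = circuit N1 C || circuit N2 C.
Proof.
have sub1 : C \subset ground N1 -> circuit direct_sum C = circuit N1 C.
  move=> sC; apply: eq_circuit => // [|D sD].
    exact: subset_trans (subsetUl _ _).
  by rewrite indep_direct_suml // (subset_trans sD).
have sub2 : C \subset ground N2 -> circuit direct_sum C = circuit N2 C.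
  move=> sC; apply: eq_circuit => // [|D sD].
    exact: subset_trans (subsetUr _ _).
  by rewrite indep_direct_sumr // (subset_trans sD).
have circuit_sub (N : matroid T) : circuit N C -> C \subset ground N.
  by case/andP=> /andP[].
apply/idP/orP=> [circC|[] circC]; last 2 first.
- by rewrite sub1 // circuit_sub.
- by rewrite sub2 // circuit_sub.
have := circuit_notin_indep circC; rewrite inE negb_and => /orP[] nI.
  have eqC : C :&: ground N1 = C.
    by apply: circuit_min circC _ _;
      rewrite ?subsetIl ?indep_direct_suml ?subsetIr.
  by left; rewrite -sub1 // -eqC subsetIr.
have sC : C :\: ground N1 \subset ground N2.
  by rewrite subDset; apply: circuit_sub circC.
have eqC : C :\: ground N1 = C.
  by apply: circuit_min circC _ _; rewrite ?subsetDl ?indep_direct_sumr.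
by right; rewrite -sub2 // -eqC.
Qed.

Lemma rank_direct_sum : rank direct_sum = rank N1 + rank N2.
Proof.
apply/eqP; rewrite eqn_leq; apply/andP; split.
  apply/rk_leqP=> C; rewrite inE => /andP[I1 I2] _.
  by rewrite -(cardsID (ground N1) C) leq_add // leq_rk // indep_ground.
have [I1 s1 c1] := basisP N1 (ground N1).
have [I2 s2 c2] := basisP N2 (ground N2); rewrite /rank -c1 -c2.
set B1 := basis _ _ in I1 s1 *; set B2 := basis _ _ in I2 s2 *.
have disjB2 : [disjoint B2 & ground N1] by rewrite disjoint_sym (disjointWr s2).
have [B2I B2D] : B2 :&: ground N1 = set0 /\ B2 :\: ground N1 = B2.
  by split; [apply/eqP; rewrite setI_eq0|apply/setDidPl].
have <- : #|B1 :|: B2| = #|B1| + #|B2|.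
  by apply/eqP; rewrite (leq_card_setU B1 B2) (disjointWl s1) // disjoint_sym.
apply: leq_rk; last exact: setUSS.
rewrite inE setIUl setDUl (setIidPl s1) B2I setU0 I1 B2D.
by have /eqP-> : B1 :\: ground N1 == set0; rewrite ?setD_eq0 ?set0U.
Qed.

Lemma is_direct_sumE N : is_direct_sum N N1 N2 <-> N = direct_sum.
Proof.
suff eqI : indep direct_sum = [set A1 :|: A2 | A1 in indep N1, A2 in indep N2].
  split=> [[_ gN iN]|->]; last by split.
  by apply: matroid_eq; rewrite // iN eqI.
apply/setP=> A; rewrite inE; apply/andP/imset2P=> [[I1 I2]|[A1 A2 I1 I2 ->]].
  by exists (A :&: ground N1) (A :\: ground N1); rewrite // setID.
have [s1 s2] := (indep_ground I1, indep_ground I2).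
have disj2 : [disjoint A2 & ground N1] by rewrite disjoint_sym (disjointWr s2).
rewrite setIUl setDUl (setIidPl s1) (setDidPl disj2).
move: disj2; rewrite -setI_eq0 => /eqP->; rewrite setU0 I1.
by have /eqP-> : A1 :\: ground N1 == set0; rewrite ?setD_eq0 ?set0U.
Qed.

End DirectSum.

Section Contraction.
Variables (T : finType) (M : matroid T).
Implicit Types X A C : {set T}.

Lemma card_setU_basis X A : A \subset ground M :\: X ->
  #|A :|: basis M X| = #|A| + #|basis M X|.
Proof.
have [_ sKX _] := basisP M X; rewrite subsetD => /andP[_ disjAX]; apply/eqP.
by rewrite (leq_card_setU A (basis M X)) (disjointWr sKX).
Qed.

Fact contraction_subproof X :
  matroid_axioms (ground M :\: X)
    [set A : {set T} | (A \subset ground M :\: X)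
                    && (A :|: basis M X \in indep M)].
Proof.
have [IK _ _] := basisP M X; apply/and4P; split.
- by apply/forall_inP=> A; rewrite inE => /andP[].
- by rewrite inE sub0set set0U.
- apply/forall_inP=> A; rewrite inE => /andP[sAE IA]; apply/forallP=> C.
  by apply/implyP=> sCA;
    rewrite inE (subset_trans sCA sAE) (indepS _ IA) ?setSU.
- apply/forall_inP=> A; rewrite inE => /andP[sAE IA]; apply/forall_inP=> C.
  rewrite inE => /andP[sCE IC]; apply/implyP=> ltAC; apply/exists_inP.
  have ltACK : #|A :|: basis M X| < #|C :|: basis M X|.
    by rewrite !card_setU_basis // ltn_add2r.
  have [x [CKx + IxAK]] := indep_augment IA IC ltACK.
  rewrite inE negb_or => /andP[nAx nKx].
  have Cx : x \in C by move: CKx; rewrite inE (negbTE nKx) orbF.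
  exists x; first by rewrite inE nAx.
  by rewrite inE subUset sub1set (subsetP sCE) // sAE -setUA.
Qed.

Definition contraction X : matroid T := Matroid (contraction_subproof X).

Lemma rk_contraction X A :
    X \subset ground M -> A \subset ground M :\: X ->
  rk (contraction X) A + rk M X = rk M (A :|: X).
Proof.
move=> sXE sAE; have [IK sKX cK] := basisP M X.
have sKAX : basis M X \subset A :|: X := subset_trans sKX (subsetUr _ _).
have [D [ID sKD sD cD]] := indep_extend IK sKAX.
have DX : D :&: X = basis M X.
  apply/esym/eqP; rewrite eqEcard subsetI sKD sKX cK.
  by rewrite leq_rk ?subsetIr // (indepS _ ID) ?subsetIl.
have sDA : D :\: X \subset A by rewrite subDset setUC.
apply/eqP; rewrite eqn_leq -{1}cK; apply/andP; split; last first.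
  rewrite -cD -(cardsID X D) DX cK addnC leq_add2r leq_rk //.
  by rewrite inE (subset_trans sDA) // -DX setUC setID.
have [+ sCA <-] := basisP (contraction X) A.
rewrite inE => /andP[sCE ICK]; rewrite -card_setU_basis //.
by apply: leq_rk ICK _; apply: setUSS.
Qed.

Lemma indep_contraction1 i A : [set i] \in indep M ->
  (A \in indep (contraction [set i])) = (i \notin A) && (i |: A \in indep M).
Proof.
move=> Ii; rewrite inE basis_id ?rk_indep // setUC subsetD1.
have [IA|_] := boolP (i |: A \in indep M); last by rewrite !andbF.
by rewrite (subset_trans (subsetUr [set i] A)) // indep_ground.
Qed.

End Contraction.

(** * Parallel elements and collinear triples *)

Lemma cards3 (T : finType) (x y z : T) :
  x != y -> x != z -> y != z -> #|[set x; y; z]| = 3.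
Proof.
move=> xy xz yz; rewrite setUC cardsU1 cards2 !inE !(eq_sym z) xy.
by rewrite (negbTE xz) (negbTE yz).
Qed.

Lemma cards3P (T : finType) (A : {set T}) :
  reflect (exists x y z, [/\ x != y, x != z, y != z & A = [set x; y; z]])
    (#|A| == 3).
Proof.
apply: (iffP eqP) => [cA|[x [y [z [xy xz yz ->]]]]]; last exact: cards3.
have /card_gt2P[x [y [z [[Ax Ay Az] [xy yz zx]]]]] : 2 < #|A| by rewrite cA.
have xz : x != z by rewrite eq_sym.
exists x, y, z; split=> //; apply/esym/eqP; rewrite eqEcard cA cards3 //.
by rewrite !subUset !sub1set Ax Ay Az.
Qed.

Section ParallelCollinear.
Variables (T : finType) (N : matroid T).
Implicit Types (x y z a b c : T) (A : {set T}).

Definition parallel x y : bool := rk N [set x; y] <= 1.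

Definition collinear x y z : bool := rk N [set x; y; z] <= 2.

Lemma indep_pair x y : x != y -> ([set x; y] \in indep N) = ~~ parallel x y.
Proof. by move=> xy; rewrite indep_rkE cards2 xy ltnNge. Qed.

Lemma indep_triple x y z : x != y -> x != z -> y != z ->
  ([set x; y; z] \in indep N) = ~~ collinear x y z.
Proof. by move=> xy xz yz; rewrite indep_rkE cards3 // ltnNge. Qed.

Lemma indep_of_pairs A : #|A| <= 2 -> {in A, forall x, [set x] \in indep N} ->
  {in A &, forall x y, x != y -> ~~ parallel x y} -> A \in indep N.
Proof.
rewrite leq_eqVlt => /orP[/cards2P[x [y [xy ->]]] _ nparA|].
  by rewrite indep_pair // nparA ?set21 ?set22.
rewrite ltnS leq_eqVlt => /orP[/cards1P[x ->] indepA _|];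
  first exact/indepA/set11.
by rewrite ltnS leqn0 cards_eq0 => /eqP-> _ _; apply: indep0.
Qed.

Lemma parallelxx x : parallel x x.
Proof. by rewrite /parallel setUid -(cards1 x) rk_card. Qed.

Lemma parallelC x y : parallel x y = parallel y x.
Proof. by rewrite /parallel setUC. Qed.

Lemma collinearC12 x y z : collinear x y z = collinear y x z.
Proof. by rewrite /collinear (setUC [set x]). Qed.

Lemma collinearC23 x y z : collinear x y z = collinear x z y.
Proof. by rewrite /collinear setUAC. Qed.

Lemma parallel_collinear x y z : parallel x y -> collinear x y z.
Proof.
by move=> pxy; rewrite /collinear setUC (leq_trans (rkU1_leq _ _ _)).
Qed.

Lemma collinearxyx x y : collinear x y x.
Proof. by rewrite collinearC23 parallel_collinear ?parallelxx. Qed.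

Lemma collinearxyy x y : collinear x y y.
Proof. by rewrite collinearC12 collinearxyx. Qed.

Lemma parallel_trans y x z :
  [set y] \in indep N -> parallel x y -> parallel y z -> parallel x z.
Proof.
move=> /rk_indep; rewrite cards1 => rky pxy pyz; rewrite /parallel -rky.
rewrite -(@rkU_eq _ _ [set y] [set x; z]) ?rkS ?subsetUr // => w.
have ge1 (v : T) : 1 <= rk N (v |: [set y]) by rewrite -rky rkS ?subsetUr.
by case/set2P=> ->; apply/eqP; rewrite rky eqn_leq ge1 andbT // setUC.
Qed.

Lemma rk_span_pair x y A : ~~ parallel x y ->
  {in A, forall w, collinear x y w} -> rk N A <= 2.
Proof.
rewrite -ltnNge => gt1 colA.
have rk2 : rk N [set x; y] = 2.
  apply/eqP; rewrite eqn_leq gt1 andbT (leq_trans (rk_card _ _)) // cards2.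
  by case: (_ != _).
rewrite -rk2 -(@rkU_eq _ _ [set x; y] A) ?rkS ?subsetUr // => w Aw.
by apply/eqP; rewrite eqn_leq (rkS _ (subsetUr _ _)) andbT rk2 setUC;
  apply: colA.
Qed.

Lemma rk_pairwise_parallel A :
  {in A &, forall x y, parallel x y} -> rk N A <= 1.
Proof.
move=> parA; apply/rk_leqP=> C IC /subsetP sCA; rewrite leqNgt.
apply/negP=> /card_gt1P[x [y [Cx Cy xy]]].
have : [set x; y] \in indep N by apply: indepS IC; rewrite subUset !sub1set Cx.
by rewrite indep_pair // parA ?sCA.
Qed.

Lemma collinear_span x y a b c : ~~ parallel x y ->
  collinear x y a -> collinear x y b -> collinear x y c -> collinear a b c.
Proof.
move=> nxy xya xyb xyc; apply: rk_span_pair nxy _ => w.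
by rewrite !inE => /orP[/orP[]|] /eqP->.
Qed.

Lemma collinear_eq x y a b c : ~~ parallel x y -> ~~ parallel a b ->
  collinear x y a -> collinear x y b -> collinear a b c = collinear x y c.
Proof.
move=> nxy nab xya xyb; apply/idP/idP=> [abc|]; last exact: collinear_span.
have abx := collinear_span nxy xya xyb (collinearxyx x y).
have aby := collinear_span nxy xya xyb (collinearxyy x y).
exact: collinear_span nab abx aby abc.
Qed.

Lemma noncollinear_third x y :
  ~~ parallel x y -> 2 < rk N setT -> exists z, ~~ collinear x y z.
Proof.
move=> nxy; rewrite ltnNge => gt2; apply/existsP; apply: contraNT gt2.
rewrite negb_exists => /forallP colN; apply: rk_span_pair nxy _ => w _.
by have := colN w; rewrite negbK.
Qed.

End ParallelCollinear.

Lemma collinearS (T : finType) (M N : matroid T) (x y z : T) :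
  indep N \subset indep M -> collinear M x y z -> collinear N x y z.
Proof. by move=> sNM; apply: leq_trans; apply: rk_indepS. Qed.

Lemma parallel_contraction1 (T : finType) (M : matroid T) (i x y : T) :
    [set i] \in indep M -> x \in ground M :\ i -> y \in ground M :\ i ->
  parallel (contraction M [set i]) x y = collinear M i x y.
Proof.
move=> Ii Ex Ey; rewrite /parallel /collinear -setUA [_ :|: [set x; y]]setUC.
have sE : [set x; y] \subset ground M :\ i by rewrite subUset !sub1set Ex.
by rewrite -(rk_contraction (indep_ground Ii) sE) (rk_indep Ii) cards1 addn1.
Qed.

Section Loopless.
Variables (T : finType) (N : matroid T).
Hypothesis looplessN : loopless N.

Lemma loopless_indep1 x : x \in ground N -> [set x] \in indep N.
Proof.
have /forallP/(_ x) := looplessN;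
  rewrite /loop /dependent sub1set negb_and negbK.
by case/orP=> [/negP|].
Qed.

Lemma parallel_classE x : x \in ground N ->
  parallel_class N x = [set y in ground N | parallel N x y].
Proof.
move=> Ex; apply/setP=> y; rewrite !inE; apply: andb_id2l => Ey.
have /forallP/(_ y)-> /= := looplessN.
have [->|yx] /= := eqVneq y x; first by rewrite parallelxx.
by rewrite /dependent subUset !sub1set Ex Ey indep_pair ?negbK // eq_sym.
Qed.

Lemma mem_parallel_classes x :
  x \in ground N -> [set y in ground N | parallel N x y] \in parallel_classes N.
Proof.
move=> Ex; rewrite -parallel_classE //; apply: imset_f.
by rewrite inE Ex; have /forallP-> := looplessN.
Qed.

End Loopless.

Lemma rank2_eq_parallel_classes (T : finType) (N N' : matroid T) :
    ground N = ground N' -> rank N <= 2 -> rank N' <= 2 ->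
    loopless N -> loopless N' -> parallel_classes N = parallel_classes N' ->
  N = N'.
Proof.
move=> eqE rN rN' lN lN' eqClasses.
have eq_parallel x y : x \in ground N -> y \in ground N ->
    parallel N x y = parallel N' x y.
  move=> Ex Ey; have := mem_parallel_classes lN Ex; rewrite eqClasses.
  case/imsetP=> x' /setIdP[Ex' _] /setP; rewrite eqE in Ex Ey *.
  rewrite parallel_classE // => eqC.
  have := eqC x; have := eqC y;
    rewrite !inE Ex Ey /= parallelxx => -> /esym x'x.
  have [Ix' Ix] := (loopless_indep1 lN' Ex', loopless_indep1 lN' Ex).
  apply/idP/idP=> [|xy]; last exact: parallel_trans Ix x'x xy.
  by apply: parallel_trans Ix' _; rewrite parallelC.
have sub (M M' : matroid T) :
    ground M = ground M' -> rank M <= 2 -> loopless M' ->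
    {in ground M &, forall x y, parallel M x y = parallel M' x y} ->
    indep M \subset indep M'.
  move=> eqE' rM lM' eqpar; apply/subsetP=> A IA; have sAE := indep_ground IA.
  apply: indep_of_pairs => [|x Ax|x y Ax Ay xy].
  - exact: leq_trans (leq_rk IA sAE) rM.
  - by rewrite loopless_indep1 // -eqE' (subsetP sAE).
  - rewrite -eqpar ?(subsetP sAE) // -indep_pair //.
    by apply: indepS IA; rewrite subUset !sub1set Ax.
apply: matroid_eq => //; apply/eqP; rewrite eqEsubset !sub //.
by move=> x y; rewrite -eqE => Ex Ey; rewrite eq_parallel.
Qed.

(** * The degenerations *)

Section LineDegeneration.
Variables (T : finType) (b : {set T}).
Implicit Types (A C : {set T}) (N : matroid T).

Definition line_degeneration : matroid T :=
  direct_sum (uniform_on b 2) (uniform_on (~: b) 1).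

Lemma indep_line_degeneration A :
  (A \in indep line_degeneration) = (#|A :&: b| <= 2) && (#|A :\: b| <= 1).
Proof. by rewrite !inE subsetIr setDE subsetIr. Qed.

Lemma indep_sub_line_degeneration N :
  rk N b <= 2 -> rk N (~: b) <= 1 -> indep N \subset indep line_degeneration.
Proof.
move=> rb rCb; apply/subsetP=> A IA; rewrite indep_line_degeneration setDE.
have IAI C : A :&: C \in indep N by apply: indepS IA; apply: subsetIl.
by rewrite (leq_trans (leq_rk (IAI _) (subsetIr _ _)) rb)
           (leq_trans (leq_rk (IAI _) (subsetIr _ _)) rCb).
Qed.

Hypotheses (b_gt1 : 1 < #|b|) (b_proper : b != setT).

Lemma rank_line_degeneration : rank line_degeneration = 3.
Proof.
rewrite rank_direct_sum ?rank_uniform_on ?disjoints_subset ?setCK //.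
by rewrite card_gt0 -setCT (inj_eq (@setC_inj T)).
Qed.

Lemma is_line_degenerationE N :
  is_line_degeneration b N <-> N = line_degeneration.
Proof.
have circE C : circuit line_degeneration C =
    ((#|C| == 3) && (C \subset b)) || ((#|C| == 2) && (C \subset ~: b)).
  rewrite circuit_direct_sum ?disjoints_subset ?setCK //.
  by rewrite !circuit_uniform_on ![(C \subset _) && _]andbC.
split=> [[gN rN cN]|->]; last first.
  by split=> [||C _]; rewrite ?rank_line_degeneration ?circE //= setUCr.
apply: (@matroid_eq_circuits_leq _ _ _ 3) => [|||C C3].
- by rewrite gN /= setUCr.
- by rewrite rN.
- by rewrite rank_line_degeneration.
- by rewrite cN ?circE.
Qed.

End LineDegeneration.

Section PointDegenerations.
Variables (T : finType) (M : matroid T) (i : T).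
Hypothesis groundM : ground M = setT.
Implicit Types (A C : {set T}) (N : matroid T).

Definition loop_degeneration : matroid T :=
  direct_sum (uniform_on [set i] 0) (deletion M i).

Lemma indep_loop_degeneration A :
  (A \in indep loop_degeneration) = (i \notin A) && (A \in indep M).
Proof.
rewrite !inE subsetIr leqn0 cards_eq0 setI_eq0 disjoint_sym disjoints1 /=.
case: (boolP (i \in A)) => //= iA.
by rewrite andbF andbT (setDidPl _) // disjoint_sym disjoints1.
Qed.

Lemma is_loop_degenerationE N :
  is_loop_degeneration M i N <-> N = loop_degeneration.
Proof.
have disj : [disjoint [set i] & setT :\ i] by rewrite disjoints1 !inE eqxx.
have ground_loop : ground loop_degeneration = setT.
  by rewrite /= groundM setTD setUCr.
have circE C : circuit loop_degeneration C <->
    circuit (deletion M i) C \/ C = [set i].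
  rewrite circuit_direct_sum ?circuit_uniform_on /= ?groundM //.
  have -> : (C \subset [set i]) && (#|C| == 1) = (C == [set i]).
    rewrite eqEcard cards1; case: (boolP (C \subset _)) => //= sC.
    by rewrite eqn_leq -(cards1 i) subset_leq_card.
  by split=> [/orP[/eqP->|]|[->|->]]; [right|left|rewrite orbT|rewrite eqxx].
split=> [[gN cN]|->]; last by split.
apply: (@matroid_eq_circuits_leq _ _ _ #|T|) => [|||C _].
- by rewrite gN ground_loop.
- exact: leq_trans (rk_card _ _) (max_card _).
- exact: leq_trans (rk_card _ _) (max_card _).
- by apply/idP/idP=> [/cN/circE|/circE/cN].
Qed.

Definition coloop_degeneration : matroid T :=
  direct_sum (uniform_on [set i] 1) (contraction M [set i]).

Hypothesis Ii : [set i] \in indep M.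

Lemma indep_coloop_degeneration A :
  (A \in indep coloop_degeneration) = (i |: A \in indep M).
Proof.
rewrite inE [_ \in indep (contraction _ _)]indep_contraction1 //.
rewrite inE subsetIr -[1](cards1 i) subset_leq_card ?subsetIr //= !inE eqxx /=.
by rewrite setDE setUIr setUCr setIT.
Qed.

Lemma is_coloop_degenerationE (B : {set {set T}}) N :
    rank M = 3 -> loopless (contraction M [set i]) ->
    parallel_classes (contraction M [set i])
      = [set b :\ i | b in [set b in B | i \in b]] ->
  is_coloop_degeneration B i N <-> N = coloop_degeneration.
Proof.
move=> rM lMi pMi.
have groundMi : ground (contraction M [set i]) = ~: [set i].
  by rewrite /= groundM setTD.
have rMi : rank (contraction M [set i]) = 2.
  have := rk_contraction (indep_ground Ii) (subxx _).
  have Ei : i \in ground M by rewrite groundM inE.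
  rewrite setUC setD1K // -/(rank _) -/(rank M) rM (rk_indep Ii) cards1 addn1.
  by case.
split=> [[N1 [N2 [[g1 r1] [g2 r2] l2 p2 sumN]]]|->].
  have eqN1 : N1 = uniform_on [set i] 1.
    by rewrite [LHS]full_rank_uniform g1 cards1.
  have eqN2 : N2 = contraction M [set i].
    by apply: rank2_eq_parallel_classes; rewrite ?groundMi ?r2 ?rMi ?p2.
  by rewrite eqN1 eqN2 in sumN *; apply/is_direct_sumE => //; case: sumN.
have disj : [disjoint [set i] & ~: [set i]] by rewrite disjoints_subset setCK.
exists (uniform_on [set i] 1), (contraction M [set i]); split=> //.
  by rewrite rank_uniform_on ?cards1.
by apply/is_direct_sumE; rewrite ?groundMi.
Qed.

End PointDegenerations.

(** * Planes *)

(* [coll_meet] allows at most one line through z to be parallel to the line xy: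
   this covers both the projective and the affine planes. *)
Record plane (T : finType) := Plane {
  coll : T -> T -> T -> bool;
  two_points : exists x y : T, x != y;
  collxxz : forall x z, coll x x z;
  collC12 : forall x y z, coll x y z = coll y x z;
  collC23 : forall x y z, coll x y z = coll x z y;
  coll_exchange : forall x y z w,
    x != y -> coll x y z -> coll x y w -> coll x z w;
  coll_third : forall x y,
    x != y -> exists z, [/\ z != x, z != y & coll x y z];
  coll_off : forall x y, x != y -> exists z, ~~ coll x y z;
  coll_meet : forall x y z w w', ~~ coll x y z -> ~~ coll z w w' ->
    exists u, coll x y u && (coll z w u || coll z w' u) }.

Arguments two_points {T}.
Arguments collxxz {T p}.
Arguments collC12 {T p}.
Arguments collC23 {T p}.
Arguments coll_exchange {T p} [x y z w].
Arguments coll_third {T} p [x y].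
Arguments coll_off {T} p [x y].
Arguments coll_meet {T p} [x y z w w'].

Definition line (T : finType) (P : plane T) (x y : T) : {set T} :=
  [set z | coll P x y z].

Definition lines (T : finType) (P : plane T) : {set {set T}} :=
  [set line P p.1 p.2 | p : T * T & p.1 != p.2].

Section Collinearity.
Variables (T : finType) (P : plane T).
Implicit Types x y z : T.

Lemma coll_rot x y z : coll P x y z = coll P y z x.
Proof. by rewrite collC12 collC23. Qed.

Lemma collC13 x y z : coll P x y z = coll P z y x.
Proof. by rewrite coll_rot collC12. Qed.

Lemma collxyx x y : coll P x y x.
Proof. by rewrite collC23 collxxz. Qed.

Lemma collxyy x y : coll P x y y.
Proof. by rewrite collC12 collxyx. Qed.

End Collinearity.

Arguments collxyx {T P}.
Arguments collxyy {T P}.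

Ltac coll_perm :=
  solve [ done | by rewrite collC12 | by rewrite collC23 | by rewrite collC13
        | by rewrite coll_rot | by rewrite -coll_rot ].

Section PlaneGeometry.
Variables (T : finType) (P : plane T).
Implicit Types (a b c i x y z u v w : T) (L : {set T}).

Lemma noncoll_neq x y z : ~~ coll P x y z -> [/\ x != y, x != z & y != z].
Proof.
move=> nxyz; split; apply: contraNneq nxyz => ->; first exact: collxxz.
  exact: collxyx.
exact: collxyy.
Qed.

Lemma coll_span x y a b c : x != y ->
  coll P x y a -> coll P x y b -> coll P x y c -> coll P a b c.
Proof.
move=> xy xya xyb xyc; have [->|xa] := eqVneq a x.
  exact: coll_exchange xy xyb xyc.
have xab := coll_exchange xy xya xyb; have xac := coll_exchange xy xya xyc.
by apply: coll_exchange xa _ _; coll_perm.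
Qed.

Lemma coll_eq x y a b c : x != y -> a != b -> coll P x y a -> coll P x y b ->
  coll P a b c = coll P x y c.
Proof.
move=> xy ab xya xyb; apply/idP/idP=> [abc|]; last exact: coll_span.
have abx := coll_span xy xya xyb (collxyx x y).
have aby := coll_span xy xya xyb (collxyy x y).
exact: coll_span ab abx aby abc.
Qed.

Lemma linesP L : reflect (exists x y, x != y /\ L = line P x y) (L \in lines P).
Proof.
apply: (iffP imsetP) => [[[x y] /= xy ->]|[x [y [xy ->]]]]; last first.
  by exists (x, y); rewrite ?inE.
by exists x, y; rewrite inE in xy.
Qed.

Lemma line_lines x y : x != y -> line P x y \in lines P.
Proof. by move=> xy; apply/linesP; exists x, y. Qed.

Lemma eq_line L x y :
  L \in lines P -> x \in L -> y \in L -> x != y -> L = line P x y.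
Proof.
move=> /linesP[a [a' [aa' ->]]]; rewrite !inE => aa'x aa'y xy.
by apply/setP=> z; rewrite !inE (coll_eq _ aa').
Qed.

Lemma lines_neq_point L i : L \in lines P -> exists2 x, x \in L & x != i.
Proof.
move=> /linesP[x [y [xy ->]]]; have [eqx|xi] := eqVneq x i.
  by exists y; rewrite ?inE ?collxyy // -eqx eq_sym.
by exists x; rewrite ?inE ?collxyx.
Qed.

Lemma lines_card L : L \in lines P -> 1 < #|L|.
Proof.
move=> /linesP[x [y [xy ->]]]; apply/card_gt1P; exists x, y.
by rewrite !inE collxyx collxyy.
Qed.

Lemma lines_proper L : L \in lines P -> L != setT.
Proof.
move=> /linesP[x [y [xy ->]]]; have [z nz] := coll_off P xy.
by apply: contraNneq nz => /setP/(_ z); rewrite !inE.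
Qed.

Lemma neq_point i : exists x, x != i.
Proof.
have [x [y xy]] := two_points P; have [eqx|xi] := eqVneq x i; last by exists x.
by exists y; rewrite -eqx eq_sym.
Qed.

Lemma line_avoiding i : exists x y, ~~ coll P x y i.
Proof.
have [y yi] := neq_point i; have [x nx] := coll_off P yi.
by exists x, y; rewrite coll_rot.
Qed.

Lemma third_off_line x y i u : x != y -> coll P x y i -> ~~ coll P x y u ->
  exists v, [/\ v != u, ~~ coll P x y v & coll P u i v].
Proof.
move=> xy xyi nu; have ui : u != i by apply: contraNneq nu => ->.
have [v [vu vi uiv]] := coll_third P ui; exists v; split=> //.
apply: contra nu => xyv; rewrite -(coll_eq u xy vi xyv xyi).
coll_perm.
Qed.

Lemma triangle_off_line L i : L \in lines P ->
  exists u v, [/\ u \notin L, v \notin L & ~~ coll P i u v].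
Proof.
move=> lL; have [Li|nLi] := boolP (i \in L).
  have [j Lj ji] := lines_neq_point i lL; rewrite (eq_line lL Lj Li ji).
  have [u nu] := coll_off P ji.
  have [v [vu nv ujv]] := third_off_line ji (collxyx j i) nu.
  exists u, v; rewrite !inE; split=> //; apply: contra nu => iuv.
  have uv : u != v by rewrite eq_sym.
  have uvj : coll P u v j by coll_perm.
  have uvi : coll P u v i by coll_perm.
  by have := coll_exchange uv uvj uvi; coll_perm.
have /linesP[x [y [xy eqL]]] := lL; rewrite eqL inE in nLi.
have [u [ui nu ixu]] := third_off_line xy (collxyx x y) nLi.
have [v [vi nv iyv]] := third_off_line xy (collxyy x y) nLi.
exists u, v; rewrite eqL !inE; split=> //; apply: contra nLi => iuv.
have iu : i != u by rewrite eq_sym.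
have iux : coll P i u x by coll_perm.
have iv : i != v by rewrite eq_sym.
have iuy : coll P i u y.
  by apply: (coll_span iv (collxyx i v)); coll_perm.
by have := coll_exchange iu iux iuy; coll_perm.
Qed.

Lemma subspace_full (X : {set T}) x y z :
    (forall u v w, u \in X -> v \in X -> u != v -> coll P u v w -> w \in X) ->
    x \in X -> y \in X -> z \in X -> ~~ coll P x y z ->
  X = setT.
Proof.
move=> subX Xx Xy Xz nxyz; have [xy xz yz] := noncoll_neq nxyz.
apply/setP=> w; rewrite inE; apply: contraT => nXw.
have zx : z != x by rewrite eq_sym.
have [t [tz tx zxt]] := coll_third P zx; have Xt := subX _ _ _ Xz Xx zx zxt.
have nxyw : ~~ coll P x y w by apply: contra nXw => /subX; apply.
have nwzt : ~~ coll P w z t.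
  apply: contra nXw => wzt; apply: (subX z t) => //; first by rewrite eq_sym.
  coll_perm.
have nxyt : ~~ coll P x y t.
  apply: contra nxyz => xyt; have xt : x != t by rewrite eq_sym.
  by apply: (coll_exchange xt); coll_perm.
have [u /andP[xyu]] := coll_meet nxyw nwzt; have Xu := subX _ _ _ Xx Xy xy xyu.
case/orP=> [wzu|wtu]; apply: contraNT nXw => _.
  apply: (subX z u) => //; last by coll_perm.
  by apply: contraNneq nxyz => ->.
apply: (subX t u) => //; last by coll_perm.
by apply: contraNneq nxyt => ->.
Qed.

Lemma off_line_connected (R : T -> T -> Prop) x y : x != y ->
    (forall u v w, R u v -> R v w -> R u w) ->
    (forall u v, ~~ coll P x y u -> ~~ coll P x y v ->
       coll P u v x \/ coll P u v y -> R u v) ->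
  forall u v, ~~ coll P x y u -> ~~ coll P x y v -> R u v.
Proof.
move=> xy transR coll_R u v nu nv.
have through u' v' w : ~~ coll P x y u' -> ~~ coll P x y v' ->
    coll P u' x w -> coll P v' y w -> R u' v'.
  move=> nu' nv' u'xw v'yw; have nw : ~~ coll P x y w.
    apply/negP=> xyw; have [eqw|wx] := eqVneq w x.
      by case/negP: nv'; rewrite -eqw; coll_perm.
    case/negP: nu'; rewrite -(coll_eq u' xy wx xyw (collxyx x y)).
    coll_perm.
  by apply: (transR _ w); apply: coll_R => //; [left|right]; coll_perm.
have [t [tu nt uyt]] := third_off_line xy (collxyy x y) nu.
have Rut : R u t by apply: coll_R => //; right; coll_perm.
have nvyx : ~~ coll P v y x by coll_perm.
have nxut : ~~ coll P x u t.
  apply: contra nu => xut; have ut : u != t by rewrite eq_sym.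
  have utx : coll P u t x by coll_perm.
  have uty : coll P u t y by coll_perm.
  by have := coll_exchange ut utx uty; coll_perm.
have [w /andP[vyw /orP[xuw|xtw]]] := coll_meet nvyx nxut.
  by apply: through vyw => //; coll_perm.
by apply: (transR _ t) => //; apply: through vyw => //; coll_perm.
Qed.

End PlaneGeometry.

(** * The matroid of a plane *)

Section LinesAreHyperplanes.
Variables (T : finType) (P : plane T) (M : matroid T).
Hypothesis hypM : is_plane_matroid (lines P) M.
Implicit Types x y z : T.

Let groundM : ground M = setT. Proof. by case: hypM. Qed.
Let rankM : rank M = 3. Proof. by case: hypM. Qed.

Let rk_line x y : x != y -> rk M (line P x y) = 2.
Proof.
move=> /line_lines-/(_ P); case: hypM => _ _ <-; rewrite inE /hyperplane rankM.
by case/andP=> /andP[_ /eqP[]].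
Qed.

Let rk_off_line x y z : ~~ coll P x y z -> 2 < rk M (z |: line P x y).
Proof.
move=> nxyz; have [xy _ _] := noncoll_neq nxyz; rewrite -(rk_line xy).
have := line_lines P xy; case: hypM => _ _ <-; rewrite inE.
case/andP=> /andP[/andP[_ /forall_inP flatL] _] _; apply: flatL.
by rewrite !inE nxyz groundM inE.
Qed.

Let indep1 x : [set x] \in indep M.
Proof.
have [y [z nyzx]] := line_avoiding P x; have [yz _ _] := noncoll_neq nyzx.
rewrite indep_rkE cards1 lt0n; apply/eqP=> rkx.
have := rk_off_line nyzx; rewrite (rkU1_eqS (sub0set _)) ?setU0 ?rk_set0 //.
by rewrite rk_line.
Qed.

Let simpleM x y : x != y -> ~~ parallel M x y.
Proof.
move=> xy; apply/negP=> pxy; have [z nxyz] := coll_off P xy.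
have nxzy : ~~ coll P x z y by rewrite collC23.
have [xz _ _] := noncoll_neq nxzy; have := rk_off_line nxzy.
have sxL : [set x] \subset line P x z by rewrite sub1set inE collxyx.
rewrite (rkU1_eqS sxL) ?rk_line //; apply/eqP; rewrite setUC eqn_leq.
by rewrite (rkS _ (subsetUl _ _)) andbT (rk_indep (indep1 x)) cards1.
Qed.

Lemma is_plane_matroid_collinear x y z : collinear M x y z = coll P x y z.
Proof.
have [<-|xy] := eqVneq x y;
  first by rewrite collxxz parallel_collinear ?parallelxx.
apply/idP/idP=> [xyz|]; last first.
  rewrite /collinear -(rk_line xy) => xyz; apply: rkS.
  by rewrite !subUset !sub1set !inE collxyx collxyy.
pose H := cl M [set x; y].
have sE : [set x; y] \subset ground M by rewrite groundM subsetT.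
have rk2 : rk M [set x; y] = 2.
  by rewrite rk_indep ?indep_pair ?simpleM // cards2 xy.
have [Hx Hy] : x \in H /\ y \in H.
  by split; apply: (subsetP (sub_cl sE)); rewrite !inE eqxx ?orbT.
have Hz : z \in H.
  rewrite inE groundM inE rk2 eqn_leq setUC -{2}rk2 rkS ?subsetUl // andbT.
  exact: xyz.
have [xz|] := eqVneq x z; first by rewrite -xz collxyx.
move=> nxz; have [yz|nyz] := eqVneq y z; first by rewrite -yz collxyy.
suff LH : H \in lines P by have := Hz; rewrite (eq_line LH Hx Hy xy) inE.
case: hypM => _ _ <-; rewrite inE /hyperplane cl_flat // rk_cl // rk2 rankM /=.
rewrite /dependent groundM subsetT indep_rkE -ltnNge rk_cl // rk2.
rewrite -(cards3 xy nxz nyz).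
by apply: subset_leq_card; rewrite !subUset !sub1set Hx Hy.
Qed.

End LinesAreHyperplanes.

Definition plane_matroid (T : finType) (P : plane T) (M : matroid T) : Prop :=
  [/\ ground M = setT, rank M = 3
    & forall x y z, collinear M x y z = coll P x y z].

Section PlaneMatroid.
Variables (T : finType) (P : plane T) (M : matroid T).
Hypothesis planeM : plane_matroid P M.
Implicit Types (i x y z : T) (A : {set T}).

Let groundM : ground M = setT. Proof. by case: planeM. Qed.
Let rankM : rank M = 3. Proof. by case: planeM. Qed.
Let collM x y z : collinear M x y z = coll P x y z. Proof. by case: planeM. Qed.

Lemma plane_simple x y : x != y -> ~~ parallel M x y.
Proof.
move=> /(coll_off P)[z]; rewrite -collM.
by apply: contra; apply: parallel_collinear.
Qed.

Lemma plane_indep2 A : #|A| <= 2 -> A \in indep M.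
Proof.
move=> A2; apply: indep_of_pairs A2 _ _ => [x _|x y _ _]; last first.
  exact: plane_simple.
have [y yx] := neq_point P x; have := plane_simple yx; rewrite -indep_pair //.
by apply: indepS; rewrite sub1set set22.
Qed.

Lemma plane_indep1 i : [set i] \in indep M.
Proof. by rewrite plane_indep2 ?cards1. Qed.

Lemma plane_indep3 x y z : ~~ coll P x y z -> [set x; y; z] \in indep M.
Proof.
move=> nxyz; have [xy xz yz] := noncoll_neq nxyz.
by rewrite indep_triple // collM.
Qed.

Lemma plane_dep3 x y z : x != y -> x != z -> y != z -> coll P x y z ->
  [set x; y; z] \notin indep M.
Proof. by move=> xy xz yz xyz; rewrite indep_triple // collM xyz. Qed.

Lemma plane_indep_card A : A \in indep M -> #|A| <= 3.
Proof. by move=> IA; rewrite -rankM; apply: leq_rk (indep_ground IA). Qed.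

Lemma rk_plane_line x y : x != y -> rk M (line P x y) <= 2.
Proof. by move=> /plane_simple/rk_span_pair; apply=> w; rewrite inE collM. Qed.

Lemma loopless_plane_contraction i : loopless (contraction M [set i]).
Proof.
apply/forallP=> x; rewrite /loop /dependent sub1set negb_and negbK.
have [->|xi] := eqVneq x i; first by rewrite /= !inE eqxx.
rewrite indep_contraction1 ?plane_indep1 // inE eq_sym xi /=.
by rewrite plane_indep2 ?orbT // cards2; case: (_ != _).
Qed.

Lemma parallel_class_plane_contraction i x : x != i ->
  parallel_class (contraction M [set i]) x = line P i x :\ i.
Proof.
move=> xi; have Ex : x \in ground M :\ i by rewrite groundM !inE xi.
rewrite parallel_classE ?loopless_plane_contraction //.
apply/setP=> y; rewrite !inE groundM inE andbT; apply: andb_id2l => yi.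
by rewrite parallel_contraction1 ?plane_indep1 ?groundM ?inE ?xi ?yi ?collM.
Qed.

Lemma parallel_classes_plane_contraction i :
  parallel_classes (contraction M [set i])
    = [set L :\ i | L in [set L in lines P | i \in L]].
Proof.
apply/setP=> Q; apply/imsetP/imsetP=> [[x]|[L]].
  rewrite !inE => /andP[/andP[xi _] _] ->; exists (line P i x).
    by rewrite inE line_lines 1?eq_sym // inE collxyx.
  by rewrite parallel_class_plane_contraction.
rewrite inE => /andP[lL Li] ->; have [x Lx xi] := lines_neq_point i lL.
exists x; last first.
  by rewrite parallel_class_plane_contraction // (eq_line lL Li Lx) // eq_sym.
by rewrite !inE xi groundM inE; have /forallP-> := loopless_plane_contraction i.
Qed.

End PlaneMatroid.

(** * Rainbow-free colourings *)

Section Colourings.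
Variables (T : finType) (P : plane T) (c : T -> nat).

Definition rainbow_free : Prop :=
  forall x y z, coll P x y z -> ~~ uniq [:: c x; c y; c z].

Definition constant_off_line : Prop :=
  exists x y k, x != y /\ forall z, ~~ coll P x y z -> c z = k.

Definition constant_on_pencil : Prop :=
  exists i, (forall x, c x = c i -> x = i) /\
    (forall x y, x != i -> y != i -> coll P i x y -> c x = c y).

Lemma rainbow_freeP : (forall x, c x < 3) ->
    (forall x y z, coll P x y z -> c x = 0 -> c y = 1 -> c z = 2 -> False) ->
  rainbow_free.
Proof.
move=> c3 rainbow x y z xyz; apply/negP.
have := c3 x; have := c3 y; have := c3 z.
case cx: (c x) => [|[|[|//]]]; case cy: (c y) => [|[|[|//]]];
case cz: (c z) => [|[|[|//]]] //= _ _ _ _.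
- exact: (rainbow x y z).
- by apply: (rainbow x z y) => //; coll_perm.
- by apply: (rainbow y x z) => //; coll_perm.
- by apply: (rainbow z x y) => //; coll_perm.
- by apply: (rainbow y z x) => //; coll_perm.
- by apply: (rainbow z y x) => //; coll_perm.
Qed.

End Colourings.

Definition rainbow_rigid (T : finType) (P : plane T) : Prop :=
  forall c : T -> nat,
    (forall x, c x < 3) -> (forall k, k < 3 -> exists x, c x = k) ->
    rainbow_free P c ->
  constant_off_line P c \/ constant_on_pencil P c.

(** * Matroids below the matroid of a plane *)

Section BelowPlane.
Variables (T : finType) (P : plane T) (M N : matroid T).
Hypotheses (rigidP : rainbow_rigid P) (planeM : plane_matroid P M).
Hypothesis sNM : indep N \subset indep M.
Hypotheses (pointN : forall x, [set x] \in indep N) (rankN : 2 < rk N setT).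
Implicit Types (x y z w p q i : T) (A : {set T}).

Definition below_line_degeneration : bool :=
  [exists L in lines P, indep N \subset indep (line_degeneration L)].

Definition below_coloop_degeneration : bool :=
  [exists i, indep N \subset indep (coloop_degeneration M i)].

Let coll_collinear x y z : coll P x y z -> collinear N x y z.
Proof. by case: planeM => _ _ <-; apply: collinearS. Qed.

Let parallelT y x z : parallel N x y -> parallel N y z -> parallel N x z.
Proof. exact: parallel_trans. Qed.

Lemma simple_below :
  (forall x y, x != y -> ~~ parallel N x y) -> indep N = indep M.
Proof.
move=> simpleN; apply/eqP; rewrite eqEsubset sNM; apply/subsetP=> A IA.
have := plane_indep_card planeM IA; rewrite leq_eqVlt => /orP[/cards3P|A2].
  case=> [x [y [z [xy xz yz eqA]]]]; rewrite eqA.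
  have nxyz : ~~ coll P x y z.
    by apply: contraTN IA => /(plane_dep3 planeM xy xz yz); rewrite -eqA.
  rewrite indep_triple //; apply/negP=> xyz.
  pose X := [set w | collinear N x y w]; have nxy := simpleN x y xy.
  suff XT : X = setT.
    by move: rankN; rewrite ltnNge -XT (rk_span_pair nxy) // => w; rewrite inE.
  apply: subspace_full (x) (y) (z) _ _ _ _ nxyz;
    rewrite ?inE ?collinearxyx ?collinearxyy // => u v w.
  rewrite !inE => xyu xyv uv uvw.
  by rewrite -(collinear_eq w nxy (simpleN u v uv)) // coll_collinear.
by apply: indep_of_pairs A2 _ _ => [x _|x y _ _];
  [apply: pointN|apply: simpleN].
Qed.

Lemma off_line_parallel x y : x != y ->
    (forall z w, ~~ coll P x y z -> ~~ coll P x y w -> parallel N z w) ->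
  below_line_degeneration.
Proof.
move=> xy par; apply/exists_inP; exists (line P x y); first exact: line_lines.
apply: indep_sub_line_degeneration.
  exact: leq_trans (rk_indepS _ sNM) (rk_plane_line planeM xy).
by apply: rk_pairwise_parallel => z w; rewrite !inE; apply: par.
Qed.

Lemma off_point_collinear p z i : ~~ parallel N p z ->
    (forall w, w != i -> collinear N p z w) ->
  below_coloop_degeneration.
Proof.
move=> npz colN; apply/existsP; exists i; apply/subsetP=> A IA.
rewrite indep_coloop_degeneration ?(plane_indep1 planeM) // (subsetP sNM) //.
apply: coloop_indep IA; apply: leq_ltn_trans rankN.
by apply: rk_span_pair npz _ => w; rewrite !inE; apply: colN.
Qed.

Lemma off_line_collinear x y p z : x != y -> ~~ parallel N p z ->
    (forall w, ~~ coll P x y w -> collinear N p z w) ->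
  below_line_degeneration || below_coloop_degeneration.
Proof.
move=> xy npz colN; have [s npzs] := noncollinear_third npz rankN.
have [/existsP[t /andP[ts npzt]]|] :=
  boolP [exists t, (t != s) && ~~ collinear N p z t]; last first.
  rewrite negb_exists => /forallP onlyS; apply/orP; right.
  apply: (off_point_collinear (i := s) npz) => w ws.
  by have := onlyS w; rewrite ws negbK.
have on_line w : ~~ collinear N p z w -> coll P x y w.
  by apply: contraR; apply: colN.
have eq_ts w : coll P t s w = coll P x y w by apply: coll_eq; rewrite ?on_line.
apply/orP; left; apply: (off_line_parallel ts).
apply: (off_line_connected (R := fun u v => parallel N u v) ts).
  by move=> u v w; apply: parallelT.
move=> u v; rewrite !eq_ts => /colN pzu /colN pzv uv_ts; apply: contraT => nuv.
by case: uv_ts => /coll_collinear; rewrite (collinear_eq _ npz nuv) // => col;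
  [case/negP: npzt|case/negP: npzs].
Qed.

Section ParallelPair.
Variables p q : T.
Hypotheses (pq : p != q) (par_pq : parallel N p q).

(* The three colours are the parallel class of p, the rest of the line of N
   through p and z, and the complement of that line. *)
Definition flag_colour z w : nat := ~~ parallel N p w + ~~ collinear N p z w.

Definition parallel_class_centre z : Prop :=
  forall u w, u != z -> w != z -> coll P z u w ->
    parallel N p u = parallel N p w.

Let par_col z w : parallel N p w -> collinear N p z w.
Proof. by move=> ppw; rewrite collinearC23 parallel_collinear. Qed.

Let flag_colour0 z w : (flag_colour z w == 0) = parallel N p w.
Proof.
rewrite /flag_colour addn_eq0 !eqb0 !negbK andb_idr //; exact: par_col.
Qed.

Let flag_colour2 z w : (flag_colour z w == 2) = ~~ collinear N p z w.
Proof.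
rewrite /flag_colour; have [ppw|] := boolP (parallel N p w);
  last by case: collinear.
by rewrite par_col.
Qed.

Let flag_colour_lt3 z w : flag_colour z w < 3.
Proof. by rewrite /flag_colour; case: parallel; case: collinear. Qed.

Lemma flag_colour_rainbow_free z :
  ~~ parallel N p z -> rainbow_free P (flag_colour z).
Proof.
move=> npz; apply: rainbow_freeP => // a b c abc /eqP.
rewrite flag_colour0 => ppa cb /eqP; rewrite flag_colour2 => /negP; apply.
have npb : ~~ parallel N p b by rewrite -(flag_colour0 z) cb.
have pzb : collinear N p z b by rewrite -[_ N p z b]negbK -flag_colour2 cb.
have nab : ~~ parallel N a b by apply: contra npb; apply: parallelT.
by rewrite -(collinear_eq c npz nab (par_col z ppa) pzb) coll_collinear.
Qed.

Lemma parallel_class_trichotomy z : ~~ parallel N p z ->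
  [\/ below_line_degeneration || below_coloop_degeneration,
      exists x y, x != y /\ forall w, collinear N p z w -> coll P x y w
    | parallel_class_centre z].
Proof.
move=> npz; have [s npzs] := noncollinear_third npz rankN.
have cp : flag_colour z p = 0 by apply/eqP; rewrite flag_colour0 parallelxx.
have cq : flag_colour z q = 0 by apply/eqP; rewrite flag_colour0.
have cz : flag_colour z z = 1 by rewrite /flag_colour npz collinearxyy.
have cs : flag_colour z s = 2 by apply/eqP; rewrite flag_colour2.
have [|[x [y [k [xy off]]]]|[i [only_i pencil]]] :=
  rigidP (flag_colour_lt3 z) _ (flag_colour_rainbow_free npz).
- by case=> [|[|[|//]]] _; [exists p|exists z|exists s].
- have [k2|nk2] := eqVneq k 2.
    constructor 2; exists x, y; split=> // w; apply: contraLR => /off cw.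
    by rewrite -flag_colour2 cw k2.
  constructor 1; apply: off_line_collinear xy npz _ => w /off cw.
  by rewrite -[collinear _ _ _ _]negbK -flag_colour2 cw.
have : flag_colour z i < 3 by [].
case ci: (flag_colour z i) only_i => [|[|[|//]]] only_i _.
- by case/eqP: pq; rewrite (only_i p cp) (only_i q cq).
- constructor 3 => u w uz wz zuw; rewrite -(only_i z cz) in pencil.
  by rewrite -!(flag_colour0 z) (pencil u w).
constructor 1; apply/orP; right; apply: (off_point_collinear (i := i) npz) => w.
by apply: contraNT; rewrite -flag_colour2 => /eqP/only_i->.
Qed.

(* If the lines of N through p and z and through p and t lie in lines of the
   plane, then these meet in p and q and hence coincide. *)
Lemma off_parallel_class_centre z :
    ~~ (below_line_degeneration || below_coloop_degeneration) ->
  ~~ parallel N p z -> parallel_class_centre z.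
Proof.
move=> /negP not_below npz.
have [//|[x [y [xy flatL]]]|//] := parallel_class_trichotomy npz.
have classL w : parallel N p w -> coll P x y w by move=> /par_col/flatL.
have ppp := parallelxx N p; have [t nt] := coll_off P xy.
have npt : ~~ parallel N p t by apply: contra nt; apply: classL.
case/negP: nt.
have [//|[x' [y' [xy' flatL']]]|centre_t] := parallel_class_trichotomy npt.
  have classL' w : parallel N p w -> coll P x' y' w by move=> /par_col/flatL'.
  rewrite -(coll_eq t xy pq (classL p ppp) (classL q par_pq)).
  rewrite (coll_eq t xy' pq (classL' p ppp) (classL' q par_pq)).
  exact/flatL'/collinearxyy.
have tp : t != p by apply: contraNneq npt => ->.
have [u [ut up tpu]] := coll_third P tp.
have ppu : parallel N p u by rewrite -(centre_t p u) // eq_sym.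
rewrite -(coll_eq t xy up (classL u ppu) (classL p ppp)); coll_perm.
Qed.

Lemma all_centres_below :
    (forall z, ~~ parallel N p z -> parallel_class_centre z) ->
  below_line_degeneration.
Proof.
move=> centre.
have [z npz] : exists z, ~~ parallel N p z.
  apply/existsP; rewrite -negb_forall; apply: contraL rankN => /forallP parN.
  rewrite -leqNgt ltnW // ltnS rk_pairwise_parallel // => x y _ _.
  by apply: (parallelT (y := p)); rewrite // parallelC.
have [w npzw] := noncollinear_third npz rankN.
have npw : ~~ parallel N p w by apply: contra npzw; apply: par_col.
have zw : z != w by apply: contraNneq npzw => <-; apply: collinearxyy.
pose X := [set u | ~~ parallel N p u].
have subX a b c : a \in X -> b \in X -> a != b -> coll P a b c -> c \in X.
  rewrite !inE => npa npb ab abc; have [->//|ca] := eqVneq c a.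
  by rewrite -(centre a npa b c) // eq_sym.
have offX u : ~~ coll P z w u -> parallel N p u.
  move=> nzwu; apply: contraT => npu.
  have /setP/(_ p) : X = setT.
    by apply: subspace_full subX _ _ _ nzwu; rewrite inE.
  by rewrite !inE parallelxx.
apply: (off_line_parallel zw) => a b /offX ppa /offX ppb.
by apply: (parallelT (y := p)); rewrite // parallelC.
Qed.

Lemma parallel_below : below_line_degeneration || below_coloop_degeneration.
Proof.
apply: contraT => not_below; have below : below_line_degeneration.
  by apply: all_centres_below => z; apply: off_parallel_class_centre.
by rewrite below in not_below.
Qed.

End ParallelPair.

End BelowPlane.

(** * The maximal degenerations *)

Section Degenerations.
Variables (T : finType) (P : plane T) (M : matroid T).
Hypothesis planeM : plane_matroid P M.
Implicit Types (i j x y z u v : T) (L A C : {set T}) (N : matroid T).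

Let groundM : ground M = setT. Proof. by case: planeM. Qed.
Let pointM i : [set i] \in indep M. Proof. exact: plane_indep1 planeM i. Qed.
Let pairM x y : [set x; y] \in indep M.
Proof. by apply: (plane_indep2 planeM); rewrite cards2; case: (_ != _). Qed.

Variant degeneration : matroid T -> Prop :=
| LineDegeneration L of L \in lines P : degeneration (line_degeneration L)
| ColoopDegeneration i : degeneration (coloop_degeneration M i)
| LoopDegeneration i : degeneration (loop_degeneration M i)
| UniformDegeneration : degeneration (uniform T 2).

Lemma degeneration_ground N : degeneration N -> ground N = setT.
Proof. by case=> [L _|i|i|] //=; rewrite ?groundM ?setTD setUCr. Qed.

Lemma line_degeneration_off_pair L u v : u \notin L -> v \notin L -> u != v ->
  [set u; v] \notin indep (line_degeneration L).
Proof.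
move=> nLu nLv uv; rewrite indep_line_degeneration negb_and -!ltnNge.
apply/orP; right; apply/card_gt1P.
by exists u, v; rewrite !inE !eqxx nLu nLv orbT.
Qed.

Lemma line_degeneration_pair L u v : u \in L ->
  [set u; v] \in indep (line_degeneration L).
Proof.
move=> Lu; rewrite indep_line_degeneration; apply/andP; split.
  apply: leq_trans (subset_leq_card (subsetIl _ _)) _.
  by rewrite cards2; case: (_ != _).
rewrite -(cards1 v) subset_leq_card //; apply/subsetP=> w; rewrite !inE.
by case/andP=> Lw /orP[/eqP eqw|//]; rewrite eqw Lu in Lw.
Qed.

Lemma line_degeneration_point L u : [set u] \in indep (line_degeneration L).
Proof.
rewrite indep_line_degeneration; apply/andP; split.
  by rewrite (leq_trans (subset_leq_card (subsetIl _ _))) ?cards1.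
by rewrite (leq_trans (subset_leq_card (subsetDl _ _))) ?cards1.
Qed.

Lemma coloop_degeneration_coll_pair i u v : u != i -> v != i -> u != v ->
  coll P i u v -> [set u; v] \notin indep (coloop_degeneration M i).
Proof.
move=> ui vi uv iuv; rewrite indep_coloop_degeneration // setUA.
by apply: (plane_dep3 planeM); rewrite // eq_sym.
Qed.

Lemma degeneration_sub N : degeneration N -> indep N \subset indep M.
Proof.
case=> [L lL|i|i|]; apply/subsetP=> A.
- rewrite indep_line_degeneration => /andP[AL AnL].
  have : #|A| <= 3 by rewrite -(cardsID L A) (leq_add AL AnL).
  rewrite leq_eqVlt => /orP[A3|]; last exact: (plane_indep2 planeM).
  have /cards3P[x [y [z [xy xz yz eqA]]]] := A3; rewrite eqA.
  apply: (plane_indep3 planeM); apply/negP=> xyz.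
  have /card_gt1P[u [v [/setIP[Au Lu] /setIP[Av Lv] uv]]] : 1 < #|A :&: L|.
    by rewrite -(leq_add2r #|A :\: L|) cardsID (eqP A3) (leq_add2l 2 _ 1).
  have sA : A \subset line P x y.
    by rewrite eqA !subUset !sub1set !inE collxyx collxyy.
  have eqL : L = line P x y.
    rewrite (eq_line lL Lu Lv uv); apply/esym/eq_line => //.
    - exact: line_lines.
    - exact: (subsetP sA).
    - exact: (subsetP sA).
  by move: AL; rewrite eqL (setIidPl sA) (eqP A3).
- by rewrite indep_coloop_degeneration //; apply: indepS; apply: subsetUr.
- by rewrite indep_loop_degeneration => /andP[].
- by rewrite inE; apply: (plane_indep2 planeM).
Qed.

Lemma sub_line_degeneration_eq N L : degeneration N -> L \in lines P ->
  indep N \subset indep (line_degeneration L) -> N = line_degeneration L.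
Proof.
move=> degN lL /subsetP sub; have [o _] := two_points P.
have eq_of_pair u v : u \notin L -> v \notin L -> u != v ->
    [set u; v] \in indep N -> N = line_degeneration L.
  move=> nLu nLv uv /sub.
  by rewrite (negbTE (line_degeneration_off_pair nLu nLv uv)).
case: degN sub eq_of_pair => [L' lL'|i|i|] sub eq_of_pair.
- have [->//|neqL] := eqVneq L' L.
  have [u Lu nLu] : exists2 u, u \in L' & u \notin L.
    apply/subsetPn; apply: contra neqL => /subsetP sL'L.
    have /linesP[x [y [xy eqL']]] := lL'.
    have [Lx Ly] : x \in L' /\ y \in L' by rewrite eqL' !inE collxyx collxyy.
    by rewrite (eq_line lL' Lx Ly xy) (eq_line lL (sL'L x Lx) (sL'L y Ly) xy).
  have [v [w [nLv _ nuvw]]] := triangle_off_line u lL.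
  have [uv _ _] := noncoll_neq nuvw.
  by apply: (eq_of_pair u v) => //; apply: line_degeneration_pair.
- have [u [v [nLu nLv niuv]]] := triangle_off_line i lL.
  have [_ _ uv] := noncoll_neq niuv; apply: (eq_of_pair u v) => //.
  by rewrite indep_coloop_degeneration // setUA (plane_indep3 planeM).
- have [u [v [nLu nLv niuv]]] := triangle_off_line i lL.
  have [iu iv uv] := noncoll_neq niuv; apply: (eq_of_pair u v) => //.
  by rewrite indep_loop_degeneration pairM !inE negb_or iu iv.
- have [u [v [nLu nLv nouv]]] := triangle_off_line o lL.
  have [_ _ uv] := noncoll_neq nouv; apply: (eq_of_pair u v) => //.
  by rewrite inE cards2 uv.
Qed.

Lemma sub_coloop_degeneration_eq N j : degeneration N ->
    indep N \subset indep (coloop_degeneration M j) ->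
  N = coloop_degeneration M j.
Proof.
move=> degN /subsetP sub; have [o oj] := neq_point P j.
have eq_of_point u : u != j ->
    (forall v, v != j -> v != u -> coll P j u v -> [set u; v] \in indep N) ->
    N = coloop_degeneration M j.
  move=> uj indepN; have ju : j != u by rewrite eq_sym.
  have [v [vj vu juv]] := coll_third P ju; have uv : u != v by rewrite eq_sym.
  have := sub _ (indepN v vj vu juv).
  by rewrite (negbTE (coloop_degeneration_coll_pair uj vj uv juv)).
case: degN sub eq_of_point => [L lL|i|i|] sub eq_of_point.
- have [u Lu uj] := lines_neq_point j lL.
  by apply: (eq_of_point u uj) => v _ _ _; apply: line_degeneration_pair.
- have [->//|ij] := eqVneq i j; apply: (eq_of_point i ij) => v _ _ _.
  by rewrite indep_coloop_degeneration // setUA setUid.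
- have [u uj niju] : exists2 u, u != j & i != j -> ~~ coll P j u i.
    have [->|ij] := eqVneq i j; first by exists o.
    have [u niju] := coll_off P ij; have [_ _ ju] := noncoll_neq niju.
    by exists u => [|_]; rewrite 1?eq_sym //; coll_perm.
  apply: (eq_of_point u uj) => v vj vu juv.
  rewrite indep_loop_degeneration pairM andbT !inE negb_or.
  have [->|ij] := eqVneq i j; first by rewrite !(eq_sym j) uj vj.
  have [_ _ ui] := noncoll_neq (niju ij); rewrite eq_sym ui.
  by apply: contraNneq (niju ij) => ->.
- by apply: (eq_of_point o oj) => v _ vu _; rewrite inE cards2 eq_sym vu.
Qed.

Lemma sub_loop_degeneration_eq N j : degeneration N ->
  indep N \subset indep (loop_degeneration M j) -> N = loop_degeneration M j.
Proof.
move=> degN /subsetP sub.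
have eq_of_loop : [set j] \in indep N -> N = loop_degeneration M j.
  by move=> /sub; rewrite indep_loop_degeneration inE eqxx.
case: degN sub eq_of_loop => [L lL|i|i|] sub eq_of_loop.
- by apply: eq_of_loop; apply: line_degeneration_point.
- by apply: eq_of_loop; rewrite indep_coloop_degeneration // pairM.
- have [->//|ij] := eqVneq i j.
  by apply: eq_of_loop; rewrite indep_loop_degeneration inE ij pointM.
- by apply: eq_of_loop; rewrite inE cards1.
Qed.

Lemma sub_uniform_eq N :
  degeneration N -> indep N \subset indep (uniform T 2) -> N = uniform T 2.
Proof.
move=> degN /subsetP sub.
have eq_of_triangle x y z :
    ~~ coll P x y z -> [set x; y; z] \in indep N -> N = uniform T 2.
  by move=> /noncoll_neq[xy xz yz] /sub; rewrite inE cards3.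
case: degN sub eq_of_triangle => [L lL|i|i|] sub eq_of_triangle //.
- have [I _] := basisP (line_degeneration L) (ground (line_degeneration L)).
  have [L_gt1 L_proper] := (lines_card lL, lines_proper lL).
  rewrite -/(rank _) rank_line_degeneration // => cI.
  by have := sub _ I; rewrite inE cI.
- have [x [y nxyi]] := line_avoiding P i; apply: (eq_of_triangle x y i nxyi).
  rewrite indep_coloop_degeneration // setUC -setUA setUid.
  exact: (plane_indep3 planeM).
have [j ji] := neq_point P i; have ij : i != j by rewrite eq_sym.
have [u [v [niu niv njuv]]] := triangle_off_line j (line_lines P ij).
apply: (eq_of_triangle j u v njuv).
rewrite indep_loop_degeneration (plane_indep3 planeM) //
  !inE !negb_or ij /= !andbT; apply/andP.
split; [apply: contraNneq niu|apply: contraNneq niv] => <-;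
  by rewrite inE collxyx.
Qed.

Lemma degeneration_antichain N N' :
  degeneration N -> degeneration N' -> indep N \subset indep N' -> N = N'.
Proof.
move=> degN [L lL|i|i|].
- exact: sub_line_degeneration_eq.
- exact: sub_coloop_degeneration_eq.
- exact: sub_loop_degeneration_eq.
- exact: sub_uniform_eq.
Qed.

Lemma degeneration_neq N : degeneration N -> N <> M.
Proof.
have [o [_ _]] := two_points P.
case=> [L lL|j|j|] /(congr1 (@indep T)) eqI.
- have [u [v [nLu nLv nouv]]] := triangle_off_line o lL.
  have [_ _ uv] := noncoll_neq nouv.
  by have := line_degeneration_off_pair nLu nLv uv; rewrite eqI pairM.
- have [u uj] := neq_point P j; have ju : j != u by rewrite eq_sym.
  have [v [vj vu juv]] := coll_third P ju; have uv : u != v by rewrite eq_sym.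
  by have := coloop_degeneration_coll_pair uj vj uv juv; rewrite eqI pairM.
- by have := pointM j; rewrite -eqI indep_loop_degeneration inE eqxx.
have [x [y nxyo]] := line_avoiding P o; have [xy xo yo] := noncoll_neq nxyo.
by have := plane_indep3 planeM nxyo; rewrite -eqI inE cards3.
Qed.

Hypothesis rigidP : rainbow_rigid P.

Lemma below_degeneration N : ground N = setT -> indep N \subset indep M ->
  N <> M -> exists2 N', degeneration N' & indep N \subset indep N'.
Proof.
move=> gN sNM neqNM.
have [rank2|rank3] := leqP (rk N setT) 2.
  exists (uniform T 2); first exact: UniformDegeneration.
  apply/subsetP=> A IA; rewrite inE.
  exact: leq_trans (leq_rk IA (subsetT A)) rank2.
have [/forallP pointN|] := boolP [forall x, [set x] \in indep N]; last first.
  rewrite negb_forall => /existsP[i Ni]; exists (loop_degeneration M i).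
    exact: LoopDegeneration.
  apply/subsetP=> A IA; rewrite indep_loop_degeneration (subsetP sNM) // andbT.
  by apply: contra Ni => Ai; apply: indepS IA; rewrite sub1set.
have [/existsP[p /existsP[q /andP[pq par_pq]]]|simpleN] :=
  boolP [exists p, exists q, (p != q) && parallel N p q].
  case/orP: (parallel_below rigidP planeM sNM pointN rank3 pq par_pq).
    case/exists_inP=> L lL sub; exists (line_degeneration L) => //.
    exact: LineDegeneration.
  case/existsP=> i sub; exists (coloop_degeneration M i) => //.
  exact: ColoopDegeneration.
case: neqNM; apply: matroid_eq; first by rewrite gN groundM.
apply: (simple_below planeM sNM pointN rank3) => x y xy.
apply: contra simpleN => par_xy.
by apply/existsP; exists x; apply/existsP; exists y; rewrite xy.
Qed.

Lemma maximal_belowE N : maximal_below M N <-> degeneration N.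
Proof.
have leE := weak_leE groundM.
have deg_lt N' : degeneration N' -> weak_lt N' M.
  move=> degN'; split; last exact: degeneration_neq.
  by apply/leE; [exact: degeneration_ground|exact: degeneration_sub].
split=> [[[leNM neqNM] maxN]|degN].
  have gN : ground N = setT by case: leNM => ->.
  have [|N' degN' sub] := below_degeneration gN _ neqNM; first exact/leE.
  rewrite -(maxN N' (deg_lt N' degN')) //.
  by apply/weak_leE; rewrite ?(degeneration_ground degN').
have gN := degeneration_ground degN.
split=> [|N' [leN'M neqN'M] leNN']; first exact: deg_lt.
have gN' : ground N' = setT by case: leN'M => ->.
have [|N'' degN'' sub] := below_degeneration gN' _ neqN'M; first exact/leE.
have sub' : indep N \subset indep N' by apply/weak_leE.
apply: matroid_eq; first by rewrite gN gN'.
apply/eqP; rewrite eqEsubset sub' andbT.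
by rewrite (degeneration_antichain degN degN'' (subset_trans sub' sub)).
Qed.

End Degenerations.

Lemma exists_unique_eq (T : finType) (p : matroid T -> Prop) (N0 : matroid T) :
  (forall N, p N <-> N = N0) -> exists! N, p N.
Proof. by move=> pE; exists N0; split=> [|N /pE->]; first exact/pE. Qed.

Theorem plane_maximal_below (T : finType) (P : plane T) (M : matroid T) :
    rainbow_rigid P -> is_plane_matroid (lines P) M ->
  [/\ forall L, L \in lines P -> exists! N, is_line_degeneration L N,
      forall i, exists! N, is_coloop_degeneration (lines P) i N,
      forall i, exists! N, is_loop_degeneration M i N
    & forall N : matroid T,
        maximal_below M N <->
        [\/ exists2 L, L \in lines P & is_line_degeneration L N,
            exists i, is_coloop_degeneration (lines P) i N,
            exists i, is_loop_degeneration M i N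
          | N = uniform T 2]].
Proof.
move=> rigidP hypM; have [groundM rankM _] := hypM.
have planeM : plane_matroid P M.
  by split=> //; apply: is_plane_matroid_collinear.
have lineE L N : L \in lines P ->
    is_line_degeneration L N <-> N = line_degeneration L.
  by move=> lL; apply: is_line_degenerationE (lines_card lL)
      (lines_proper lL) N.
have coloopE i N :
    is_coloop_degeneration (lines P) i N <-> N = coloop_degeneration M i.
  apply: is_coloop_degenerationE => //; first exact: plane_indep1 planeM i.
    exact: loopless_plane_contraction planeM i.
  exact: parallel_classes_plane_contraction planeM i.
have loopE i N : is_loop_degeneration M i N <-> N = loop_degeneration M i.
  exact: is_loop_degenerationE.
split=> [L lL|i|i|N].
- by apply: (exists_unique_eq (N0 := line_degeneration L)) => N; apply: lineE.
- exact: exists_unique_eq (coloopE i).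
- exact: exists_unique_eq (loopE i).
apply: iff_trans (maximal_belowE planeM rigidP N) _.
split=> [[L lL|i|i|]|[[L lL /lineE->//]|[i /coloopE->]|[i /loopE->]|->]].
- by constructor 1; exists L => //; apply/lineE.
- by constructor 2; exists i; apply/coloopE.
- by constructor 3; exists i; apply/loopE.
- by constructor 4.
- exact: LineDegeneration.
- exact: ColoopDegeneration.
- exact: LoopDegeneration.
- exact: UniformDegeneration.
Qed.

(** * Rigidity by exhaustive search *)

Section Search.
Variables (d : nat) (C : nat -> nat -> nat -> bool).
Implicit Types (s col : seq nat) (a b i k : nat).

Definition constant_off_line_code s : bool :=
  has (fun a => has (fun b => (a != b) && has (fun k =>
    all (fun i => C a b i || (nth 0 s i == k)) (iota 0 d)) (iota 0 3))
    (iota 0 d)) (iota 0 d).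

Definition constant_on_pencil_code s : bool :=
  has (fun a =>
    all (fun i => (nth 0 s i == nth 0 s a) ==> (i == a)) (iota 0 d) &&
    all (fun i => all (fun j =>
      [|| i == a, j == a, ~~ C a i j | nth 0 s i == nth 0 s j]) (iota 0 d))
      (iota 0 d)) (iota 0 d).

Definition rigid_code s : bool :=
  constant_off_line_code s || constant_on_pencil_code s.

Definition rainbow_rcons s k : bool :=
  has (fun a => has (fun b =>
    C a b (size s) && uniq [:: nth 0 s a; nth 0 s b; k])
    (iota 0 (size s))) (iota 0 (size s)).

(* [if], since the strict evaluation of [||] would not prune the search. *)
Fixpoint rainbow_search n s : bool :=
  if n is n'.+1 then
    all (fun k => if rainbow_rcons s k then true
                  else rainbow_search n' (rcons s k)) (iota 0 3)
  else rigid_code s.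

Lemma rainbow_search_sound col n s :
    size col = d -> (forall k, k \in col -> k < 3) ->
    (forall a b i, a < d -> b < d -> i < d -> C a b i ->
       ~~ uniq [:: nth 0 col a; nth 0 col b; nth 0 col i]) ->
    prefix s col -> size s + n = d -> rainbow_search n s ->
  rigid_code col.
Proof.
move=> size_col col3 no_rainbow; elim: n s => [|n IHn] s.
  rewrite addn0 => /prefixP[t eqcol] size_s.
  have : size s + size t = size s by rewrite -size_cat -eqcol size_col size_s.
  by rewrite -[RHS]addn0 => /addnI/size0nil t0; rewrite eqcol t0 cats0.
rewrite addnS => /prefixP[[|k t] eqcol] size_s.
  by move: (leqnn d); rewrite -{1}size_s -size_col eqcol cats0 ltnNge leq_addr.
have nth_s a : a < size s -> nth 0 s a = nth 0 col a.
  by rewrite eqcol nth_cat => ->.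
have nth_k : nth 0 col (size s) = k by rewrite eqcol nth_cat ltnn subnn.
have lt_sd : size s < d by rewrite -size_s ltnS leq_addr.
have k3 : k \in iota 0 3.
  by rewrite mem_iota col3 // eqcol mem_cat mem_head orbT.
move=> /allP/(_ k k3); case: ifP => [/hasP[a]|_]; last first.
  by apply: IHn; rewrite ?size_rcons // eqcol -cat_rcons prefix_prefix.
rewrite mem_iota add0n => /= lt_as /hasP[b]; rewrite mem_iota add0n => /= lt_bs.
rewrite !nth_s // -nth_k => /andP[Cab rainbow].
have lt_ad := ltn_trans lt_as lt_sd; have lt_bd := ltn_trans lt_bs lt_sd.
by have /negP[] := no_rainbow _ _ _ lt_ad lt_bd lt_sd Cab.
Qed.

End Search.

Section SearchSound.
Variables (T : finType) (P : plane T) (d : nat) (C : nat -> nat -> nat -> bool).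

Definition plane_code (h : T -> 'I_d) : Prop :=
  bijective h /\ forall x y z, coll P x y z = C (h x) (h y) (h z).

Section Code.
Variables (h : T -> 'I_d) (c : T -> nat) (col : seq nat).
Hypotheses (codeP : plane_code h) (nth_col : forall x, nth 0 col (h x) = c x).

Let h_inj : injective h. Proof. by case: codeP => /bij_inj. Qed.
Let collE x y z : coll P x y z = C (h x) (h y) (h z).
Proof. by case: codeP. Qed.

Let all_point (p : pred nat) x : all p (iota 0 d) -> p (h x).
Proof. by move=> /allP; apply; rewrite mem_iota ltn_ord. Qed.

Let has_point (p : pred nat) : has p (iota 0 d) -> exists x, p (h x).
Proof.
have [[g _ gK] _] := codeP; case/hasP=> k; rewrite mem_iota => /andP[_ ltk] pk.
by exists (g (Ordinal ltk)); rewrite gK.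
Qed.

Lemma constant_off_line_codeP :
  constant_off_line_code d C col -> constant_off_line P c.
Proof.
case/has_point=> x /has_point[y /andP[xy /hasP[k _ const]]].
exists x, y, k; split=> [|z]; first by apply: contraNneq xy => ->.
by rewrite collE; have := all_point z const; rewrite nth_col;
  case: C => //= /eqP.
Qed.

Lemma constant_on_pencil_codeP :
  constant_on_pencil_code d C col -> constant_on_pencil P c.
Proof.
case/has_point=> x /andP[single pencil]; exists x; split=> [y eqyx|y z yx zx].
  have := all_point y single; rewrite !nth_col eqyx eqxx /= val_eqE.
  by move/eqP/h_inj.
rewrite collE; have := all_point z (all_point y pencil).
rewrite !nth_col !val_eqE !(inj_eq h_inj) (negbTE yx) (negbTE zx) /=.
by move=> /orP[/negbTE->//|/eqP].
Qed.

End Code.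

Lemma rainbow_rigid_search :
    (forall x y z, ~~ coll P x y z -> exists2 h : T -> 'I_d, plane_code h
       & [/\ val (h x) = 0, val (h y) = 1 & val (h z) = 2]) ->
    rainbow_search d C (d - 3) (iota 0 3) ->
  rainbow_rigid P.
Proof.
move=> frame search c c3 c_onto no_rainbow.
have [x cx] := c_onto 0 isT; have [y cy] := c_onto 1 isT.
have [z cz] := c_onto 2 isT.
have nxyz : ~~ coll P x y z by apply/negP=> /no_rainbow; rewrite cx cy cz.
have [h codeP [hx hy hz]] := frame x y z nxyz; have [[g hK gK] collE] := codeP.
pose col := [seq c (g k) | k <- enum 'I_d].
have size_col : size col = d by rewrite size_map size_enum_ord.
have nth_ord (k : 'I_d) : nth 0 col k = c (g k).
  by rewrite (nth_map k) ?size_enum_ord // nth_ord_enum.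
have nth_col w : nth 0 col (h w) = c w by rewrite nth_ord hK.
have col0 : nth 0 col 0 = 0 by rewrite -[RHS]cx -nth_col hx.
have col1 : nth 0 col 1 = 1 by rewrite -[RHS]cy -nth_col hy.
have col2 : nth 0 col 2 = 2 by rewrite -[RHS]cz -nth_col hz.
have d_gt2 : 2 < d by rewrite -hz ltn_ord.
have : rigid_code d C col.
  apply: rainbow_search_sound search => //.
  - by move=> k /mapP[j _ ->].
  - move=> a b i lt_ad lt_bd lt_id; rewrite -[a]/(val (Ordinal lt_ad)).
    rewrite -[b]/(val (Ordinal lt_bd)) -[i]/(val (Ordinal lt_id)) !nth_ord.
    move=> Cabi; apply: no_rainbow.
    by rewrite collE !gK.
  - rewrite prefixE; apply/eqP/(@eq_from_nth _ 0);
      rewrite size_takel ?size_col //.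
    by case=> [|[|[|//]]] _; rewrite nth_take.
  - by rewrite size_iota subnKC.
case/orP=> rigid_col; [left|right].
  exact: constant_off_line_codeP codeP nth_col rigid_col.
exact: constant_on_pencil_codeP codeP nth_col rigid_col.
Qed.

End SearchSound.

(** * Coded planes *)

Section CodedPoints.
Variables (q : nat) (add mul : nat -> nat -> nat).
Variable pts : seq (nat * nat * nat).
Implicit Types m n p : nat * nat * nat.

Definition code_comb a b m n : nat * nat * nat :=
  (add (mul a m.1.1) (mul b n.1.1), add (mul a m.1.2) (mul b n.1.2),
   add (mul a m.2) (mul b n.2)).

Definition code_span m n p : bool :=
  has (fun a => has (fun b => code_comb a b m n == p) (iota 0 q)) (iota 0 q).

Definition code_ok m : bool := [&& m.1.1 < q, m.1.2 < q & m.2 < q].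

Definition code_point k : nat * nat * nat := nth (0, 0, 0) pts k.

Definition code_coll i j k : bool :=
  (i == j) || code_span (code_point i) (code_point j) (code_point k).

Definition code_frame : seq (nat * nat * nat) :=
  [:: (1, 0, 0); (0, 1, 0); (0, 0, 1)].

Definition code_wf : bool :=
  [&& all code_ok pts, prefix code_frame pts
    & pairwise (fun m n => ~~ code_span n n m) pts].

Definition code_coll_table : seq (seq (seq bool)) :=
  let d := size pts in
  mkseq (fun i => mkseq (fun j => mkseq (code_coll i j) d) d) d.

End CodedPoints.

Definition table_lookup (t : seq (seq (seq bool))) i j k : bool :=
  nth false (nth [::] (nth [::] t i) j) k.

Lemma table_lookupE q add mul pts i j k :
    i < size pts -> j < size pts -> k < size pts ->
  table_lookup (code_coll_table q add mul pts) i j k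
    = code_coll q add mul pts i j k.
Proof. by move=> ltid ltjd ltkd; rewrite /table_lookup !nth_mkseq. Qed.

Definition rigid_check q add mul pts : bool :=
  code_wf q add mul pts &&
  rainbow_search (size pts) (table_lookup (code_coll_table q add mul pts))
    (size pts - 3) (iota 0 3).

Definition triples q : seq (nat * nat * nat) :=
  [seq (p, c) | p <- [seq (a, b) | a <- iota 0 q, b <- iota 0 q],
                c <- iota 0 q].

Definition frame_first (s : seq (nat * nat * nat)) : seq (nat * nat * nat) :=
  code_frame ++ [seq m <- s | m \notin code_frame].

(* Homogeneous coordinates, with leading coefficient 1. *)
Definition PG_points q : seq (nat * nat * nat) :=
  frame_first [seq m <- triples q |
    if m.1.1 == 0 then if m.1.2 == 0 then m.2 == 1 else m.1.2 == 1
    else m.1.1 == 1].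

(* Barycentric coordinates. *)
Definition AG_points q (add : nat -> nat -> nat) : seq (nat * nat * nat) :=
  frame_first [seq m <- triples q | add (add m.1.1 m.1.2) m.2 == 1].

Definition add_mod q a b : nat := (a + b) %% q.

Definition mul_mod q a b : nat := (a * b) %% q.

(* The codes 0, 1, 2, 3 stand for 0, 1, w, 1 + w, where w ^ 2 = 1 + w. *)
Definition add4 a b : nat :=
  nth 0 (nth [::] [:: [:: 0; 1; 2; 3]; [:: 1; 0; 3; 2];
                      [:: 2; 3; 0; 1]; [:: 3; 2; 1; 0]] a) b.

Definition mul4 a b : nat :=
  nth 0 (nth [::] [:: [:: 0; 0; 0; 0]; [:: 0; 1; 2; 3];
                      [:: 0; 2; 3; 1]; [:: 0; 3; 1; 2]] a) b.

Lemma PG2_check : rigid_check 2 (add_mod 2) (mul_mod 2) (PG_points 2).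
Proof. by vm_compute. Qed.

Lemma PG3_check : rigid_check 3 (add_mod 3) (mul_mod 3) (PG_points 3).
Proof. by vm_compute. Qed.

Lemma AG3_check :
  rigid_check 3 (add_mod 3) (mul_mod 3) (AG_points 3 (add_mod 3)).
Proof. by vm_compute. Qed.

Lemma AG4_check : rigid_check 4 add4 mul4 (AG_points 4 add4).
Proof. by vm_compute. Qed.

(** * Planes of points in a three-dimensional vector space *)

Import GRing.Theory.
Local Open Scope ring_scope.

Lemma vline_eq (F : fieldType) (vT : vectType F) (u v : vT) :
  u != 0 -> u \in <[v]>%VS -> <[u]>%VS = <[v]>%VS.
Proof.
move=> nu uv; apply/eqP; rewrite eqEdim -memvE uv /= !dim_vline nu.
by case: (v != 0).
Qed.

(* The points are the lines <[v]> of vT that do not lie in H: a projective plane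
   when H = 0, an affine plane when H has dimension 2. *)
Record vector_points (F : fieldType) (vT : vectType F) (H : {vspace vT})
    (T : finType) (V : T -> vT) : Prop := VectorPoints {
  dim_vector_points : \dim {:vT} = 3%N;
  vector_off : exists v, v \notin H;
  vector_point_off : forall x, V x \notin H;
  vector_point_onto : forall v, v \notin H -> exists x, <[V x]>%VS = <[v]>%VS;
  vector_point_inj : forall x y, <[V x]>%VS = <[V y]>%VS -> x = y;
  vector_point_comb : forall x y, x != y ->
    exists2 a, a != 0 & V x + a *: V y \notin H }.

Section VectorPlane.
Variables (F : fieldType) (vT : vectType F) (H : {vspace vT}).
Variables (T : finType) (V : T -> vT).
Hypothesis pointsV : vector_points H V.
Implicit Types x y z w : T.

Definition vector_coll x y z : bool := ~~ free [:: V x; V y; V z].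

Lemma vector_point_neq0 x : V x != 0.
Proof.
by apply: contraNneq (vector_point_off pointsV x) => ->; apply: mem0v.
Qed.

Lemma vector_point_mem x y : V x \in <[V y]>%VS -> x = y.
Proof.
by move/(vline_eq (vector_point_neq0 x)); apply: vector_point_inj pointsV _ _.
Qed.

Lemma vector_points_free x y : x != y -> free [:: V x; V y].
Proof.
rewrite free_cons span_seq1 seq1_free vector_point_neq0 andbT.
by apply: contra => /vector_point_mem->.
Qed.

Lemma dim_span_vector_points x y : x != y -> \dim <<[:: V x; V y]>> = 2%N.
Proof. by move/vector_points_free/eqP. Qed.

Lemma vector_collC12 x y z : vector_coll x y z = vector_coll y x z.
Proof.
by rewrite /vector_coll (perm_free (Y := [:: V y; V x; V z])) //;
  apply: (permEl (perm_catCA [:: _] [:: _] [:: _])).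
Qed.

Lemma vector_collC23 x y z : vector_coll x y z = vector_coll x z y.
Proof.
by rewrite /vector_coll (perm_free (Y := [:: V x; V z; V y])) // perm_cons;
  apply: (permEl (perm_catC [:: _] [:: _])).
Qed.

Lemma vector_collxxz x z : vector_coll x x z.
Proof. by apply/negP=> /free_uniq; rewrite /= inE eqxx. Qed.

Lemma vector_collE x y z :
  x != y -> vector_coll x y z = (V z \in <<[:: V x; V y]>>%VS).
Proof.
move=> xy; rewrite vector_collC23 vector_collC12 /vector_coll free_cons.
by rewrite vector_points_free // andbT negbK.
Qed.

Lemma vector_coll_span x y z (W : {vspace vT}) : (\dim W <= 2)%N ->
  V x \in W -> V y \in W -> V z \in W -> vector_coll x y z.
Proof.
move=> W2 Wx Wy Wz; apply/negP=> /eqP /= dim3; move: W2; rewrite leqNgt -dim3.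
rewrite dimvS //; apply/span_subvP=> v.
by rewrite !inE => /or3P[] /eqP->.
Qed.

Lemma vector_coll_exchange x y z w :
  x != y -> vector_coll x y z -> vector_coll x y w -> vector_coll x z w.
Proof.
move=> xy; rewrite !(vector_collE _ xy) => xyz xyw.
apply: (@vector_coll_span _ _ _ <<[:: V x; V y]>>%VS) => //.
  by rewrite dim_span_vector_points.
by rewrite memv_span ?inE ?eqxx.
Qed.

Lemma vector_coll_third x y : x != y ->
  exists z, [/\ z != x, z != y & vector_coll x y z].
Proof.
move=> xy; have [a na nH] := vector_point_comb pointsV xy.
have [z eqz] := vector_point_onto pointsV nH.
have Vz : V x + a *: V y \in <[V z]>%VS by rewrite eqz memv_line.
exists z; split.
- apply: contraNneq xy => eqzx; move: Vz; rewrite eqzx rpredDl ?memv_line //.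
  by rewrite rpredZeq (negbTE na) => /vector_point_mem->.
- apply: contraNneq xy => eqzy; move: Vz.
  by rewrite eqzy rpredDr ?rpredZ ?memv_line // => /vector_point_mem->.
rewrite vector_collE // memvE eqz -memvE.
by rewrite rpredD ?rpredZ // memv_span // !inE eqxx ?orbT.
Qed.

(* A vector space is not the union of two proper subspaces. *)
Lemma vector_point_between (U W : {vspace vT}) :
    ~~ (U <= H)%VS -> ~~ (U <= W)%VS ->
  exists2 x, V x \in U & V x \notin W.
Proof.
move=> /subvPn[u Uu nHu] /subvPn[v Uv nWv].
have point (w : vT) : w \in U -> w \notin H -> w \notin W ->
    exists2 x, V x \in U & V x \notin W.
  move=> Uw /(vector_point_onto pointsV)[x eqx] nWw.
  by exists x; rewrite memvE eqx -memvE.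
have [Wu|nWu] := boolP (u \in W); last exact: point Uu nHu nWu.
have [Hv|nHv] := boolP (v \in H); last exact: point Uv nHv nWv.
apply: (point (u + v)); first exact: rpredD.
  by rewrite (rpredDr _ Hv).
by rewrite (rpredDl _ Wu).
Qed.

Lemma vector_point_outside (W : {vspace vT}) :
  (\dim W <= 2)%N -> exists x, V x \notin W.
Proof.
move=> W2; have [||x _ nWx] := @vector_point_between fullv W; last by exists x.
  by have [v nv] := vector_off pointsV; apply/subvPn; exists v; rewrite ?memvf.
by apply: contraTN W2 => /dimvS; rewrite (dim_vector_points pointsV) ltnNge.
Qed.

Lemma vector_coll_off x y : x != y -> exists z, ~~ vector_coll x y z.
Proof.
move=> xy; have [|z nz] := @vector_point_outside <<[:: V x; V y]>>%VS.
  by rewrite dim_span_vector_points.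
by exists z; rewrite vector_collE.
Qed.

Lemma vector_two_points : exists x y : T, x != y.
Proof.
have [|x _] := @vector_point_outside 0%VS; first by rewrite dimv0.
have [|y nxy] := @vector_point_outside <[V x]>%VS.
  by rewrite dim_vline vector_point_neq0.
by exists x, y; apply: contraNneq nxy => ->; apply: memv_line.
Qed.

Lemma vector_noncoll_neq x y z :
  ~~ vector_coll x y z -> [/\ x != y, x != z & y != z].
Proof.
rewrite negbK => /free_uniq /=; rewrite !inE negb_or.
case/and3P=> [/andP[xy xz] yz _].
by split; [move: xy|move: xz|move: yz]; apply: contraNneq => ->.
Qed.

Lemma span_vector_pointsl x y : V x \in <<[:: V x; V y]>>%VS.
Proof. by rewrite memv_span ?mem_head. Qed.

Lemma vector_lines_meet x y z w
    (W := <<[:: V x; V y]>>%VS) (U := <<[:: V z; V w]>>%VS) :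
    x != y -> z != w ->
  (exists u, vector_coll x y u && vector_coll z w u) \/
  (W :&: U != 0 /\ W :&: U = W :&: H)%VS.
Proof.
move=> xy zw; have [WUH|] := boolP (W :&: U <= H)%VS; last first.
  move=> /subvPn[v /memv_capP[Wv Uv] /(vector_point_onto pointsV)[u equ]]; left.
  by exists u; rewrite !vector_collE // ![V u \in _]memvE equ -!memvE Wv.
have dimWU : (0 < \dim (W :&: U))%N.
  have := dimv_sum_cap W U; rewrite !dim_span_vector_points //.
  have := dimvS (subvf (W + U)); rewrite (dim_vector_points pointsV).
  by case: (\dim (W :&: U)) => // + eq4; rewrite addn0 in eq4 *; rewrite eq4.
right; split; first by rewrite -dimv_eq0 -lt0n.
apply/eqP; rewrite eqEdim subv_cap capvSl WUH; apply: leq_trans dimWU.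
rewrite -ltnS -(dim_span_vector_points xy) ltn_neqAle dimvS ?capvSl // andbT.
rewrite (dimv_leqif_eq (capvSl W H)) eqEsubv capvSl subv_cap subvv /=.
apply/negP=> /subvP/(_ _ (span_vector_pointsl x y)).
exact/negP/(vector_point_off pointsV).
Qed.

Lemma cap_vector_pencil z w w' : ~~ vector_coll z w w' ->
  (<<[:: V z; V w]>> :&: <<[:: V z; V w']>> = <[V z]>)%VS.
Proof.
move=> nzww'; have [zw zw' _] := vector_noncoll_neq nzww'.
apply/esym/eqP; rewrite eqEdim -memvE memv_cap !span_vector_pointsl dim_vline.
rewrite vector_point_neq0 -(leq_add2l 3).
have sub : (<<[:: V z; V w; V w']>>
              <= <<[:: V z; V w]>> + <<[:: V z; V w']>>)%VS.
  apply/span_subvP=> v; rewrite !inE => /or3P[] /eqP->.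
  - by rewrite (subvP (addvSl _ _)) ?memv_span // !inE eqxx.
  - by rewrite (subvP (addvSl _ _)) ?memv_span // !inE eqxx orbT.
  - by rewrite (subvP (addvSr _ _)) ?memv_span // !inE eqxx orbT.
have := dimvS sub; have := nzww'; rewrite negbK => /eqP-> /= dim3.
have := dimv_sum_cap <<[:: V z; V w]>> <<[:: V z; V w']>>.
by rewrite !dim_span_vector_points // => dim4; rewrite -[leqRHS]dim4 leq_add2r.
Qed.

(* If neither of the two lines through z met the line xy in a point, they would
   all have the same direction. *)
Lemma vector_coll_meet x y z w w' :
  ~~ vector_coll x y z -> ~~ vector_coll z w w' ->
  exists u, vector_coll x y u && (vector_coll z w u || vector_coll z w' u).
Proof.
move=> nxyz nzww'; have [xy _ _] := vector_noncoll_neq nxyz.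
have [zw zw' _] := vector_noncoll_neq nzww'.
have [[u /andP[xyu zwu]]|[nWU eqWU]] := vector_lines_meet xy zw.
  by exists u; rewrite xyu zwu.
have [[u /andP[xyu zw'u]]|[_ eqWU']] := vector_lines_meet xy zw'.
  by exists u; rewrite xyu zw'u orbT.
case/negP: nxyz; rewrite vector_collE //.
set v := vpick (<<[:: V x; V y]>> :&: <<[:: V z; V w]>>)%VS.
have WUv : v \in (<<[:: V x; V y]>> :&: <<[:: V z; V w]>>)%VS := memv_pick _.
have /memv_capP[Wv Uv] := WUv.
have /memv_capP[_ U'v] : v \in (<<[:: V x; V y]>> :&: <<[:: V z; V w']>>)%VS.
  by rewrite eqWU' -eqWU.
have vz : v \in <[V z]>%VS by rewrite -(cap_vector_pencil nzww') memv_cap Uv.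
by rewrite memvE -(vline_eq _ vz) -?memvE // vpick0.
Qed.

Definition vector_plane : plane T :=
  Plane vector_two_points vector_collxxz vector_collC12 vector_collC23
        vector_coll_exchange vector_coll_third vector_coll_off vector_coll_meet.

End VectorPlane.

Section Projective.
Variables (F : fieldType) (T : finType) (phi : T -> {vspace 'rV[F]_3}).
Hypothesis phi_inj : injective phi.
Hypothesis phi_onto :
  forall U : {vspace 'rV[F]_3}, \dim U = 1%N <-> exists x, phi x = U.

Definition proj_vector x : 'rV[F]_3 := vpick (phi x).

Lemma proj_vector_neq0 x : proj_vector x != 0.
Proof.
rewrite vpick0 -dimv_eq0; suff -> : \dim (phi x) = 1%N by [].
by apply/phi_onto; exists x.
Qed.

Lemma vline_proj_vector x : <[proj_vector x]>%VS = phi x.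
Proof.
have dim1 : \dim (phi x) = 1%N by apply/phi_onto; exists x.
apply/eqP; rewrite eqEdim -memvE memv_pick dim1 dim_vline.
by rewrite proj_vector_neq0.
Qed.

Lemma proj_vector_points : vector_points 0%VS proj_vector.
Proof.
split=> [||x|v|x y|x y xy].
- by rewrite dimvf /dim /= mul1n.
- exists (const_mx 1); rewrite memv0; apply/eqP=> /rowP/(_ 0)/eqP.
  by rewrite !mxE oner_eq0.
- by rewrite memv0 proj_vector_neq0.
- rewrite memv0 => nv; have /phi_onto[x eqx] : \dim <[v]>%VS = 1%N.
    by rewrite dim_vline nv.
  by exists x; rewrite vline_proj_vector.
- by rewrite !vline_proj_vector; apply: phi_inj.
exists 1; rewrite ?oner_eq0 // scale1r memv0 addr_eq0.
apply: contra xy => /eqP eqx; apply/eqP/phi_inj; rewrite -!vline_proj_vector.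
by apply: vline_eq (proj_vector_neq0 x) _; rewrite eqx rpredN memv_line.
Qed.

Lemma lines_projective_plane (B : {set {set T}}) :
    (forall b : {set T}, b \in B <->
       exists W : {vspace 'rV[F]_3},
         \dim W = 2%N /\ b = [set x | (phi x <= W)%VS]) ->
  B = lines (vector_plane proj_vector_points).
Proof.
move=> phiB; set V := proj_vector; have pointsV := proj_vector_points.
have phiE x (W : {vspace 'rV[F]_3}) : (phi x <= W)%VS = (V x \in W).
  by rewrite memvE vline_proj_vector.
apply/setP=> b; apply/idP/linesP=> [/phiB[W [dimW ->]]|[x [y [xy ->]]]];
  last first.
  apply/phiB; exists <<[:: V x; V y]>>%VS; split.
    exact: (dim_span_vector_points pointsV xy).
  by apply/setP=> z; rewrite !inE phiE; exact: (vector_collE pointsV _ xy).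
have point_in U : (\dim U <= 1)%N -> exists2 x, V x \in W & V x \notin U.
  move=> dimU; apply: (vector_point_between pointsV).
    by rewrite subv0 -dimv_eq0 dimW.
  by apply: contraTN dimU => /dimvS; rewrite dimW ltnNge.
have [|x Wx _] := point_in 0%VS; first by rewrite dimv0.
have [|y Wy nxy] := point_in <[V x]>%VS.
  by rewrite dim_vline proj_vector_neq0.
have xy : x != y by apply: contraNneq nxy => ->; apply: memv_line.
have eqW : <<[:: V x; V y]>>%VS = W.
  apply/eqP; rewrite eqEdim dimW (dim_span_vector_points pointsV xy) andbT.
  by apply/span_subvP=> v; rewrite !inE => /orP[] /eqP->.
exists x, y; split=> //; apply/setP=> z; rewrite !inE phiE.
by rewrite [RHS](vector_collE pointsV _ xy) eqW.
Qed.

End Projective.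

Section Affine.
Variables (F : finFieldType) (T : finType) (phi : T -> 'rV[F]_2).
Hypotheses (F_gt2 : (2 < #|F|)%N) (phi_bij : bijective phi).

Let phi_onto v : exists x, phi x = v.
Proof. by case: phi_bij => g _ gK; exists (g v); rewrite gK. Qed.

Definition aff_vector x : (F^o * 'rV[F]_2)%type := (1, phi x).

Definition line_at_infinity : {vspace (F^o * 'rV[F]_2)%type} :=
  lker (linfun (fst : F^o * 'rV[F]_2 -> F^o)).

Lemma mem_line_at_infinity v : (v \in line_at_infinity) = (v.1 == 0).
Proof. by rewrite memv_ker lfunE. Qed.

Lemma aff_vector_points : vector_points line_at_infinity aff_vector.
Proof.
have off x : aff_vector x \notin line_at_infinity.
  by rewrite mem_line_at_infinity oner_eq0.
split=> [||//|[a v]|x y|x y _].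
- by rewrite dimvf.
- by exists (1, 0); rewrite mem_line_at_infinity oner_eq0.
- rewrite mem_line_at_infinity /= => na; have [x eqx] := phi_onto (a^-1 *: v).
  have eqV : aff_vector x = a^-1 *: (a, v).
    by rewrite /aff_vector eqx; congr (_, _); apply/esym/mulVf.
  exists x; apply: vline_eq; last by rewrite eqV rpredZ ?memv_line.
  by apply: contraNneq (off x) => ->; apply: mem0v.
- move=> eqxy; have /vlineP[c [+ eqphi]] : aff_vector x \in <[aff_vector y]>%VS.
    by rewrite -eqxy memv_line.
  rewrite [_ *: _]mulr1 => eqc; rewrite -eqc scale1r in eqphi.
  exact: bij_inj phi_bij _ _ eqphi.
have /subsetPn[a _ na] : ~~ ([set: F] \subset [set 0; -1]).
  apply: contraTN F_gt2 => /subset_leq_card; rewrite cardsT cards2 -leqNgt.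
  by move/leq_trans; apply; case: (_ != _).
move: na; rewrite !inE negb_or => /andP[na na1]; exists a => //.
by rewrite mem_line_at_infinity /= [_ *: _]mulr1 addrC addr_eq0.
Qed.

Lemma span_aff_vectorE x y z :
  (aff_vector z \in <<[:: aff_vector x; aff_vector y]>>%VS)
    = (phi z - phi x \in <[phi y - phi x]>%VS).
Proof.
rewrite span_cons span_seq1;
  apply/memv_addP/vlineP=> [[_ /vlineP[a ->]]|[c eqz]].
  case=> _ /vlineP[b ->] [+ ->]; rewrite /= ![_ *: 1]mulr1 => eq1.
  exists b; rewrite (_ : a = 1 - b); last by rewrite eq1 addrK.
  rewrite scalerBl scale1r scalerBr addrAC (addrAC (phi x)) subrr add0r.
  by rewrite addrC.
exists ((1 - c) *: aff_vector x); first by rewrite rpredZ ?memv_line.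
exists (c *: aff_vector y); first by rewrite rpredZ ?memv_line.
congr (_, _); first by rewrite /= ![_ *: 1]mulr1 subrK.
move/eqP: eqz; rewrite subr_eq => /eqP->.
rewrite /= scalerBl scale1r scalerBr addrAC.
by rewrite [c *: phi y + _]addrC [RHS]addrAC.
Qed.

Lemma lines_affine_plane (B : {set {set T}}) :
    (forall b : {set T}, b \in B <->
       exists (v : 'rV[F]_2) (U : {vspace 'rV[F]_2}),
         \dim U = 1%N /\ b = [set x | phi x - v \in U]) ->
  B = lines (vector_plane aff_vector_points).
Proof.
move=> phiB; have phi_inj := bij_inj phi_bij.
have line_aff x y : x != y ->
    line (vector_plane aff_vector_points) x y
      = [set z | phi z - phi x \in <[phi y - phi x]>%VS].
  move=> xy; apply/setP=> z; rewrite !inE -span_aff_vectorE.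
  exact: (vector_collE aff_vector_points _ xy).
apply/setP=> b; apply/idP/linesP=> [/phiB[v [U [dimU ->]]]|[x [y [xy ->]]]];
  last first.
  apply/phiB; exists (phi x), <[phi y - phi x]>%VS; split; last exact: line_aff.
  by rewrite dim_vline subr_eq0 (inj_eq phi_inj) eq_sym xy.
have nu : vpick U != 0 by rewrite vpick0 -dimv_eq0 dimU.
have eqU : <[vpick U]>%VS = U.
  by apply/eqP; rewrite eqEdim -memvE memv_pick dimU dim_vline nu.
have [x eqx] := phi_onto v; have [y eqy] := phi_onto (vpick U + v).
have xy : x != y.
  rewrite -(inj_eq phi_inj) eqx eqy -subr_eq0 opprD addrCA subrr addr0.
  by rewrite oppr_eq0.
by exists x, y; split=> //; rewrite line_aff // eqx eqy addrK eqU.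
Qed.

End Affine.

(** * Coordinates in a frame *)

Record field_code (F : fieldType) (q : nat) (add mul : nat -> nat -> nat)
    (el : nat -> F) : Prop := FieldCode {
  code0 : el 0%N = 0;
  code1 : el 1%N = 1;
  code_inj : {in gtn q &, injective el};
  code_onto : forall x, exists2 a, (a < q)%N & el a = x;
  code_add : {in gtn q &, forall a b,
    (add a b < q)%N /\ el (add a b) = el a + el b};
  code_mul : {in gtn q &, forall a b,
    (mul a b < q)%N /\ el (mul a b) = el a * el b} }.

Lemma free3_eq0 (F : fieldType) (vT : vectType F) (u v w : vT) (a b c : F) :
  free [:: u; v; w] -> a *: u + b *: v + c *: w = 0 ->
    [/\ a = 0, b = 0 & c = 0].
Proof.
move=> free_uvw comb0.
have /freeP indep_uvw : free [tuple u; v; w] := free_uvw.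
have := indep_uvw (fun i => [:: a; b; c]`_i).
rewrite !big_ord_recl big_ord0 /= addr0 addrA => /(_ comb0) coef0.
by split; [apply: (coef0 0)|apply: (coef0 1)|apply: (coef0 ord_max)].
Qed.

Section Coordinates.
Variables (F : fieldType) (q : nat) (add mul : nat -> nat -> nat).
Variable el : nat -> F.
Hypothesis codeF : field_code q add mul el.
Variables (vT : vectType F) (u v w : vT).
Hypothesis frame : free [:: u; v; w].
Implicit Types m n p : nat * nat * nat.

Definition coord_vector m : vT := el m.1.1 *: u + el m.1.2 *: v + el m.2 *: w.

Lemma coord_vector_inj : {in code_ok q &, injective coord_vector}.
Proof.
move=> [[a b] c] [[a' b'] c'] /and3P[/= lta ltb ltc] /and3P[/= lta' ltb' ltc'].
move/eqP; rewrite /coord_vector -subr_eq0 !opprD addrACA (addrACA (_ *: u)).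
rewrite -!scalerBl => /eqP/(free3_eq0 frame)[/subr0_eq eqa /subr0_eq eqb].
move=> /subr0_eq/(code_inj codeF ltc ltc')->.
by rewrite (code_inj codeF lta lta' eqa) (code_inj codeF ltb ltb' eqb).
Qed.

Lemma coord_vector_comb a b m n :
    (a < q)%N -> (b < q)%N -> code_ok q m -> code_ok q n ->
  code_ok q (code_comb add mul a b m n) /\
  coord_vector (code_comb add mul a b m n)
    = el a *: coord_vector m + el b *: coord_vector n.
Proof.
move=> lta ltb; case: m n => [[m1 m2] m3] [[n1 n2] n3].
move=> /and3P[/= ltm1 ltm2 ltm3] /and3P[/= ltn1 ltn2 ltn3].
have comb s t : (s < q)%N -> (t < q)%N ->
    (add (mul a s) (mul b t) < q)%N /\
    el (add (mul a s) (mul b t)) = el a * el s + el b * el t.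
  move=> lts ltt; have [ltas eqas] := code_mul codeF lta lts.
  have [ltbt eqbt] := code_mul codeF ltb ltt.
  by have [lt_add eq_add] := code_add codeF ltas ltbt; rewrite eq_add eqas eqbt.
have [[lt1 eq1] [lt2 eq2]] := (comb _ _ ltm1 ltn1, comb _ _ ltm2 ltn2).
have [lt3 eq3] := comb _ _ ltm3 ltn3.
split; first by rewrite /code_ok /= lt1 lt2 lt3.
rewrite /coord_vector /= eq1 eq2 eq3 !scalerDr !scalerDl !scalerA.
by rewrite [RHS]addrACA (addrACA ((el a * el m1) *: u)).
Qed.

Lemma code_spanE m n p : code_ok q m -> code_ok q n -> code_ok q p ->
  code_span q add mul m n p
    = (coord_vector p \in <[coord_vector m]> + <[coord_vector n]>)%VS.
Proof.
move=> okm okn okp; apply/hasP/memv_addP=> [[a + /hasP[b]]|].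
  rewrite !mem_iota !add0n => /= lta ltb /eqP <-.
  have [_ ->] := coord_vector_comb lta ltb okm okn.
  exists (el a *: coord_vector m); first by rewrite rpredZ ?memv_line.
  by exists (el b *: coord_vector n); first by rewrite rpredZ ?memv_line.
case=> _ /vlineP[s ->] [_ /vlineP[t ->] eqp].
have [[a lta eqa] [b ltb eqb]] := (code_onto codeF s, code_onto codeF t).
have [okab eqab] := coord_vector_comb lta ltb okm okn.
exists a; rewrite ?mem_iota //; apply/hasP; exists b; rewrite ?mem_iota //.
by apply/eqP/coord_vector_inj; rewrite // eqab eqp eqa eqb.
Qed.

End Coordinates.

Section CodedPlane.
Variables (F : fieldType) (q : nat) (add mul : nat -> nat -> nat).
Variable el : nat -> F.
Variable pts : seq (nat * nat * nat).
Hypothesis codeF : field_code q add mul el.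
Hypothesis checked : rigid_check q add mul pts.
Variables (vT : vectType F) (H : {vspace vT}) (T : finType) (V : T -> vT).
Hypotheses (pointsV : vector_points H V) (cardT : #|T| = size pts).
Hypothesis pts_off : forall x y z m, ~~ vector_coll V x y z -> m \in pts ->
  coord_vector el (V x) (V y) (V z) m \notin H.

Let wf_pts : code_wf q add mul pts. Proof. by case/andP: checked. Qed.

Let code_ok_point (k : 'I_(size pts)) : code_ok q (code_point pts k).
Proof. by case/and3P: wf_pts => /allP okP _ _; apply/okP/mem_nth. Qed.

Lemma coded_point_bij x y z : ~~ vector_coll V x y z ->
  exists2 g : 'I_(size pts) -> T, bijective g
    & forall k, <[V (g k)]>%VS
        = <[coord_vector el (V x) (V y) (V z) (code_point pts k)]>%VS.
Proof.
move=> nxyz; have frame := negbNE nxyz.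
have /fin_all_exists[g lineg] : forall k : 'I_(size pts), exists t,
    <[V t]>%VS = <[coord_vector el (V x) (V y) (V z) (code_point pts k)]>%VS.
  by move=> k; apply: (vector_point_onto pointsV); apply/pts_off/mem_nth.
exists g => //; apply: inj_card_bij; last by rewrite cardT card_ord.
have lt_inj (i j : 'I_(size pts)) : (i < j)%N -> g i <> g j.
  move=> ltij eqg; case/and3P: wf_pts => _ _ /(pairwiseP (0, 0, 0)%N) indep_pts.
  have := indep_pts i j (ltn_ord i) (ltn_ord j) ltij.
  rewrite (code_spanE codeF frame) ?code_ok_point // -!lineg addvv -eqg lineg.
  by rewrite memv_line.
move=> i j eqg; apply: val_inj.
by have [/lt_inj/(_ eqg)|/lt_inj/(_ (esym eqg))|] := ltngtP i j.
Qed.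

Lemma coded_frame x y z : ~~ vector_coll V x y z ->
  exists2 h : T -> 'I_(size pts),
    bijective h /\ forall s t r,
      vector_coll V s t r = code_coll q add mul pts (h s) (h t) (h r)
  & [/\ val (h x) = 0%N, val (h y) = 1%N & val (h z) = 2%N].
Proof.
move=> nxyz; have frame := negbNE nxyz.
have [g [h gK hK] lineg] := coded_point_bij nxyz.
have anchor k t : (k < size pts)%N ->
    coord_vector el (V x) (V y) (V z) (code_point pts k) = V t -> val (h t) = k.
  move=> ltk coord_t; rewrite (_ : h t = Ordinal ltk) //.
  apply: (can_inj gK); rewrite hK; apply: (vector_point_inj pointsV).
  by rewrite lineg coord_t.
have [code0F code1F] := (code0 codeF, code1 codeF).
have /and3P[_ /prefixP[rest eqpts] _] := wf_pts.
exists h; last first.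
  split; apply: anchor; rewrite ?eqpts // /code_point /coord_vector /=;
    rewrite code0F code1F scale1r !scale0r.
  - by rewrite !addr0.
  - by rewrite addr0 add0r.
  - by rewrite !add0r.
split=> [|s t r]; first by exists g.
have h_inj := can_inj hK.
have [<-|st] := eqVneq s t; first by rewrite vector_collxxz /code_coll eqxx.
rewrite (vector_collE pointsV) // /code_coll val_eqE (inj_eq h_inj).
rewrite (negbTE st) (code_spanE codeF frame) ?code_ok_point // -!lineg !hK.
rewrite [coord_vector _ _ _ _ _ \in _]memvE -lineg hK -memvE.
by rewrite span_cons span_seq1.
Qed.

Lemma vector_plane_rigid : rainbow_rigid (vector_plane pointsV).
Proof.
case/andP: checked => _; set C := table_lookup _ => search.
apply: rainbow_rigid_search search => x y z /coded_frame[h [h_bij collE] hxyz].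
exists h => //; split=> // s t r; rewrite /C table_lookupE ?ltn_ord //.
exact: collE.
Qed.

End CodedPlane.

(** * The four planes *)

Lemma code_onto_card (F : finFieldType) q (el : nat -> F) :
    #|F| = q -> {in gtn q &, injective el} ->
  forall x, exists2 a, (a < q)%N & el a = x.
Proof.
move=> cardF el_inj x; pose f (a : 'I_q) := el a.
have f_inj : injective f.
  by move=> a b /(el_inj a b (ltn_ord a) (ltn_ord b))/val_inj.
have /codomP[a ->] : x \in codom f.
  by apply: inj_card_onto; rewrite // cardF card_ord.
by exists a.
Qed.

Lemma prime_field_code (F : finFieldType) p : prime p -> #|F| = p ->
  exists el : nat -> F, field_code p (add_mod p) (mul_mod p) el.
Proof.
move=> pr_p cardF; exists (fun a => a%:R); have charF : p \in [pchar F].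
  by apply: (@card_finPcharP _ p 1); rewrite // expn1.
have natr_mod a : (a %% p)%:R = a%:R :> F.
  by rewrite {2}(divn_eq a p) natrD natrM (pcharf0 charF) mulr0 add0r.
have inj : {in gtn p &, injective (fun a => a%:R : F)}.
  move=> a b; rewrite !inE.
  wlog le_ab : a b / (a <= b)%N => [sym lta ltb eqab|_ ltb /eqP].
    by have /orP[le|le] := leq_total a b; [apply: sym|apply/esym/sym].
  rewrite eq_sym -subr_eq0 -natrB // -(dvdn_pcharf charF) => p_dvd; apply/eqP.
  rewrite eqn_leq le_ab -subn_eq0 -leqn0 leqNgt; apply/negP=> gt0.
  by have := dvdn_leq gt0 p_dvd; rewrite leqNgt (leq_ltn_trans (leq_subr _ _)).
split=> //; first exact: code_onto_card.
- by move=> a b _ _; rewrite ltn_mod prime_gt0 // natr_mod natrD.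
- by move=> a b _ _; rewrite ltn_mod prime_gt0 // natr_mod natrM.
Qed.

Lemma field4_generator (F : finFieldType) : #|F| = 4%N ->
  exists w : F, [/\ w != 0, w != 1 & w * w = 1 + w].
Proof.
move=> cardF; have charF : 2%N \in [pchar F] by apply: (@card_finPcharP _ 2 2).
have /subsetPn[w _] : ~~ ([set: F] \subset [set 0; 1]).
  apply/negP=> /subset_leq_card; rewrite cardsT cardF.
  by rewrite cards2; case: (_ != _).
rewrite !inE negb_or => /andP[w0 w1]; exists w; split=> //.
have w3 : w ^+ 3 - 1 = 0.
  apply: (mulfI w0); rewrite mulr0 mulrBr mulr1 -exprS -cardF.
  by rewrite expf_card subrr.
move/eqP: w3; rewrite subrX1 mulf_eq0 subr_eq0 (negbTE w1) /=.
rewrite !big_ord_recl big_ord0 expr0 expr1 addr0 addrA addrC addr_eq0 => /eqP.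
by rewrite (oppr_pchar2 charF).
Qed.

Lemma field4_code (F : finFieldType) : #|F| = 4%N ->
  exists el : nat -> F, field_code 4 add4 mul4 el.
Proof.
move=> cardF; have charF : 2%N \in [pchar F] by apply: (@card_finPcharP _ 2 2).
have [w [w0 w1 ww]] := field4_generator cardF.
have xx (x : F) : x + x = 0 by rewrite addrr_pchar2.
have w1w : w * (1 + w) = 1 by rewrite mulrDr mulr1 ww addrCA xx addr0.
pose el a := nth 0 [:: 0; 1; w; 1 + w] a.
have uniq_el : uniq [:: 0; 1; w; 1 + w].
  have w10 : 1 + w != 0 by rewrite addr_eq0 (oppr_pchar2 charF) eq_sym.
  rewrite /= !inE !negb_or !(eq_sym 0) oner_eq0 w0 w10 (eq_sym 1) w1 /=.
  rewrite -[X in X == 1 + w]addr0 (inj_eq (addrI 1)) eq_sym w0.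
  by rewrite -[X in X == 1 + w]add0r (inj_eq (addIr w)) eq_sym oner_eq0.
have el_inj : {in gtn 4 &, injective el}.
  by move=> a b lta ltb /eqP; rewrite nth_uniq // => /eqP.
exists el; split=> //; first exact: code_onto_card.
- move=> [|[|[|[|//]]]] [|[|[|[|//]]]] _ _; split=> //; rewrite /el /=;
    first [by rewrite ?add0r ?addr0 ?xx | by rewrite addrA xx add0r
          | by rewrite addrC | by rewrite addrCA xx addr0
          | by rewrite addrAC xx add0r | by rewrite -addrA xx addr0].
- move=> [|[|[|[|//]]]] [|[|[|[|//]]]] _ _; split=> //; rewrite /el /=;
    first [by rewrite ?mul0r ?mulr0 ?mul1r ?mulr1 | by rewrite ww
          | by rewrite w1w | by rewrite mulrC w1w
          | by rewrite mulrDl mul1r w1w addrAC xx add0r].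
Qed.

Section RigidPlanes.
Variables (q : nat) (add mul : nat -> nat -> nat) (pts : seq (nat * nat * nat)).
Hypothesis fieldq : forall F : finFieldType, #|F| = q ->
  exists el : nat -> F, field_code q add mul el.
Hypothesis checked : rigid_check q add mul pts.
Variable B : {set {set 'I_(size pts)}}.

Let code_ok_pts m : m \in pts -> code_ok q m.
Proof. by case/andP: checked => /and3P[/allP okP _ _] _ /okP. Qed.

Lemma PG_rigid_plane : (0, 0, 0)%N \notin pts -> is_PG2 q B ->
  exists2 P : plane 'I_(size pts), rainbow_rigid P & B = lines P.
Proof.
move=> pts_neq0 [F [phi [cardF phi_inj phi_onto phiB]]].
have [el codeF] := fieldq cardF.
have pointsV := proj_vector_points phi_inj phi_onto.
exists (vector_plane pointsV); last exact: lines_projective_plane.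
apply: (vector_plane_rigid codeF checked); first exact: card_ord.
move=> x y z m nxyz pts_m; rewrite memv0; apply: contraNneq pts_neq0 => coord0.
suff <- : m = (0, 0, 0)%N by [].
have ok_m := code_ok_pts pts_m.
apply: (coord_vector_inj codeF (negbNE nxyz)) => //.
  have /and3P[lt_q _ _] := ok_m.
  by apply/and3P; split; apply: leq_ltn_trans lt_q.
by rewrite coord0 /coord_vector /= (code0 codeF) !scale0r !addr0.
Qed.

Lemma AG_rigid_plane : (2 < q)%N ->
    all (fun m => add (add m.1.1 m.1.2) m.2 == 1%N) pts -> is_AG2 q B ->
  exists2 P : plane 'I_(size pts), rainbow_rigid P & B = lines P.
Proof.
move=> q_gt2 /allP sum1 [F [phi [cardF phi_bij phiB]]].
have [el codeF] := fieldq cardF; rewrite -cardF in q_gt2.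
have pointsV := aff_vector_points q_gt2 phi_bij.
exists (vector_plane pointsV); last exact: lines_affine_plane.
apply: (vector_plane_rigid codeF checked); first exact: card_ord.
move=> x y z m _ pts_m; rewrite mem_line_at_infinity /= ![_ *: 1]mulr1.
have /and3P[lt1 lt2 lt3] := code_ok_pts pts_m.
have [lt12 eq12] := code_add codeF lt1 lt2.
have [_ eq123] := code_add codeF lt12 lt3.
by rewrite -eq12 -eq123 (eqP (sum1 m pts_m)) (code1 codeF) oner_eq0.
Qed.

End RigidPlanes.

Local Close Scope ring_scope.

Theorem theorem7p3 (d : nat) (B : {set {set 'I_d}}) (M : matroid 'I_d)
    (hB : [\/ d = 7 /\ is_PG2 2 B, d = 13 /\ is_PG2 3 B,
              d = 9 /\ is_AG2 3 B | d = 16 /\ is_AG2 4 B])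
    (hM : is_plane_matroid B M) :
  [/\ forall b, b \in B -> exists! N, is_line_degeneration b N,
      forall i, exists! N, is_coloop_degeneration B i N,
      forall i, exists! N, is_loop_degeneration M i N
    & forall N : matroid 'I_d,
        maximal_below M N <->
        [\/ exists2 b, b \in B & is_line_degeneration b N,
            exists i, is_coloop_degeneration B i N,
            exists i, is_loop_degeneration M i N
          | N = uniform 'I_d 2]].
Proof.
suff [P rigidP eqB] : exists2 P : plane 'I_d, rainbow_rigid P & B = lines P.
  by rewrite eqB in hM *; apply: plane_maximal_below.
case: hB => -[eqd] {hM}; subst d.
- by apply: (PG_rigid_plane _ PG2_check) => // F; apply: prime_field_code.
- by apply: (PG_rigid_plane _ PG3_check) => // F; apply: prime_field_code.
- by apply: (AG_rigid_plane _ AG3_check) => // F; apply: prime_field_code.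
- by apply: (AG_rigid_plane field4_code AG4_check).
Qed.
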